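(* Let $r\ge4$ and let $A=(a_{ijk})$, $i,j\in\{1,2\}$, $k\in\{1,\dots,r\}$, be a nonzero hypermatrix of format $(2,2,r)$ with entries in $\mathbb{C}$, with associated matrices of linear forms $L,M$ ($2\times r$) and $N$ ($2\times 2$) and associated schemes $\mathcal L,\mathcal M\subseteq\mathbb{P}^1$, $\mathcal N\subseteq\mathbb{P}^{r-1}$. Then exactly one of the following cases occurs, and in each case the stated conclusions hold. (1a) $r=4$ and $\mathcal N$ is a smooth quadric in $\mathbb{P}^3$. Then $A$ is non-degenerate, concise, and has tensor rank $4$. (1b) $r\ge5$ and $\mathcal N$ is a cone over a smooth quadric of $\mathbb{P}^3$. Then $A$ is non-degenerate, has tensor rank $4$, and is not concise, with $F_{ess}(A)=(2,2,4)$. (2) $\mathcal N$ is a cone over a smooth conic of $\mathbb{P}^2$ (i.e. the vertex of the cone is a linear space of dimension $r-4$ in $\mathbb{P}^{r-1}$). Then $A$ is non-degenerate, not concise, $F_{ess}(A)=(2,2,3)$ and $A$ has tensor rank $3$. (3a) $\mathcal N$ is made of two distinct hyperplanes and $\mathcal L$ is a simple point in $\mathbb{P}^1$. Then $A$ is degenerate, $F_{ess}(A)=(2,2,3)$ and $A$ has tensor rank $3$. (3b) $\mathcal N$ is made of two distinct hyperplanes and $\mathcal L$ is made of two simple points in $\mathbb{P}^1$. Then $A$ is degenerate, $F_{ess}(A)=(2,2,2)$ and $A$ has tensor rank $2$. (4a) $\mathcal N$ is a double hyperplane and the $2\times2$ minors of $L$ define a double point in $\mathbb{P}^1$. Then $A$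 is degenerate, $F_{ess}(A)=(2,2,2)$ and $A$ has tensor rank $3$. (4b) $\mathcal N$ is a double hyperplane and the $2\times 2$ minors of $L$ vanish identically (i.e. $\mathcal L=\mathbb{P}^1$). Then $A$ is degenerate, $F_{ess}(A)=(2,2,1)$ and $A$ has tensor rank $2$. (5a) $\det N$ vanishes identically (i.e. $\mathcal N=\mathbb{P}^{r-1}$), one between $\mathcal L$ and $\mathcal M$ is a double point and the other is all of $\mathbb{P}^1$. Then $A$ is degenerate, $F_{ess}(A)=(1,2,2)$ or $F_{ess}(A)=(2,1,2)$, and $A$ has tensor rank $2$. (5b) $\det N$ vanishes identically and $\mathcal L=\mathcal M=\mathbb{P}^1$ (all $2\times2$ minors of $L$ and $M$ vanish identically). Then $A$ is degenerate, has tensor rank $1$ and $F_{ess}(A)=(1,1,1)$.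
   Context: Associated matrices: $L=(L_{jk})$ is $2\times r$ with $L_{jk}=\sum_i a_{ijk}x_i$; $M=(M_{ik})$ is $2\times r$ with $M_{ik}=\sum_j a_{ijk}y_j$; $N=(N_{ij})$ is $2\times2$ with $N_{ij}=\sum_k a_{ijk}z_k$. The associated schemes $\mathcal L,\mathcal M\subseteq\mathbb{P}^1$, $\mathcal N\subseteq\mathbb{P}^{r-1}$ are the projective schemes defined by the ideals generated by the $2\times2$ minors of $L,M,N$ respectively. A double point in $\mathbb{P}^1$, resp. a double hyperplane in $\mathbb{P}^{r-1}$, is the scheme defined by the square of a nonzero linear form. A cone over a smooth quadric of $\mathbb{P}^3$ (resp. smooth conic of $\mathbb{P}^2$) in $\mathbb{P}^{r-1}$ is a quadric hypersurface which in suitable linear coordinates is defined by the equation of a smooth quadric in $4$ (resp. $3$) of the coordinates. Degeneracy: $A$ is degenerate if there is $(x,y,z)\in\mathbb{P}^1\times\mathbb{P}^1\times\mathbb{P}^{r-1}$ with $\sum_{i,j}a_{ijk}x_iy_j=0$ for all $k$, $\sum_{i,k}a_{ijk}x_iz_k=0$ for all $j$ and $\sum_{j,k}a_{ijk}y_jz_k=0$ for all $i$. Tensor rank of $A$: the minimal number of decomposable tensors $u\otimes v\otimes w$ whose sum is $\sum a_{ijk}\,\varepsilon_i\otimes\eta_j\otimes\zeta_k\in\mathbb{C}^2\otimes\mathbb{C}^2\otimes\mathbb{C}^r$, where $(\varepsilon_i),(\eta_j),(\zeta_k)$ are the fixed bases. Conciseness and essential format: let $P_A=\sum a_{ijk}x_iy_jz_k$.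 The essential format $F_{ess}(A)$ is the (componentwise) minimum $(p',q',r')$ such that there are linear forms $x'_1,\dots,x'_{p'}$ in the $x_i$, $y'_1,\dots,y'_{q'}$ in the $y_j$, $z'_1,\dots,z'_{r'}$ in the $z_k$ with $P_A$ a trihomogeneous polynomial of degree $(1,1,1)$ in $x',y',z'$. $A$ is concise if $F_{ess}(A)=(2,2,r)$. *)

(* Defs.v *)
(* The complex numbers are R[i] for R : realType. *)
From mathcomp Require Import all_boot all_order all_algebra.
From mathcomp Require Export complex reals.
From mathcomp Require Export mpoly.

Set Implicit Arguments.
Unset Strict Implicit.
Unset Printing Implicit Defensive.

Import GRing.Theory.
Local Open Scope ring_scope.

(* Closed subschemes of projective space. A subscheme of P^{n-1} is given by a
   homogeneous ideal of F[X_0, ..., X_{n-1}]; two ideals define the same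
   subscheme iff they have the same saturation with respect to the irrelevant
   ideal. *)
Section ProjectiveSchemes.
Variables (F : fieldType) (n : nat).
Implicit Types (f q : {mpoly F[n]}) (S I J : {mpoly F[n]} -> Prop).

Definition ideal_gen S f : Prop :=
  exists m (g h : 'I_m -> {mpoly F[n]}),
    (forall t, S (h t)) /\ f = \sum_(t < m) g t * h t.

Definition principal q : {mpoly F[n]} -> Prop := ideal_gen (fun h => h = q).

Definition saturation I f : Prop :=
  forall i : 'I_n, exists m : nat, I ('X_i ^+ m * f).

Definition same_scheme I J : Prop :=
  forall f, saturation I f <-> saturation J f.

(* The intersection of ideals defines the scheme-theoretic union. *)
Definition idealI I J f : Prop := I f /\ J f.

Definition linear_form (c : 'rV[F]_n) : {mpoly F[n]} := \sum_i c 0 i *: 'X_i.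

Definition is_whole_space I : Prop := same_scheme I (principal 0).

(* In P^1 (n = 2), a hyperplane is a simple point, a double hyperplane is a
   double point, and two distinct hyperplanes are two simple points. *)
Definition is_hyperplane I : Prop :=
  exists2 c, c != 0 & same_scheme I (principal (linear_form c)).

Definition is_double_hyperplane I : Prop :=
  exists2 c, c != 0 & same_scheme I (principal (linear_form c ^+ 2)).

Definition is_two_hyperplanes I : Prop :=
  exists c d : 'rV[F]_n,
    [/\ c != 0, d != 0,
        ~ same_scheme (principal (linear_form c)) (principal (linear_form d))
      & same_scheme I
          (idealI (principal (linear_form c)) (principal (linear_form d)))].

(* Jacobian criterion: the hypersurface q = 0 has no singular point. *)
Definition smooth_quadratic_form q : Prop :=
  q \is 2.-homog /\
  forall p : 'rV[F]_n, p != 0 -> q.@[p 0] = 0 -> exists i, q^`M(i).@[p 0] != 0.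

Definition is_smooth_quadric I : Prop :=
  exists2 q, smooth_quadratic_form q & same_scheme I (principal q).

End ProjectiveSchemes.

(* The rows of the invertible matrix T are the new coordinates, of which those
   indexed by s occur in the equation. *)
Definition is_cone_over_smooth_quadric (F : fieldType) (m n : nat)
    (I : {mpoly F[n]} -> Prop) : Prop :=
  exists (T : 'M[F]_n) (s : 'I_m -> 'I_n) (q : {mpoly F[m]}),
    [/\ T \in unitmx, injective s, smooth_quadratic_form q &
        same_scheme I
          (principal (q \mPo [tuple linear_form (row (s i) T) | i < m]))].

Definition minors2 (S : comNzRingType) (m n : nat) (B : 'M[S]_(m, n)) (d : S)
    : Prop :=
  exists (f : 'I_2 -> 'I_m) (g : 'I_2 -> 'I_n),
    [/\ (f ord0 < f ord_max)%N, (g ord0 < g ord_max)%N & d = \det (mxsub f g B)].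

Definition hypermatrix (F : fieldType) (p q r : nat) :=
  {ffun 'I_p * 'I_q * 'I_r -> F}.

Section Hypermatrices.
Variables (F : fieldType) (p q r : nat) (A : hypermatrix F p q r).

Definition matL : 'M[{mpoly F[p]}]_(q, r) :=
  \matrix_(j, k) \sum_i A (i, j, k) *: 'X_i.
Definition matM : 'M[{mpoly F[q]}]_(p, r) :=
  \matrix_(i, k) \sum_j A (i, j, k) *: 'X_j.
Definition matN : 'M[{mpoly F[r]}]_(p, q) :=
  \matrix_(i, j) \sum_k A (i, j, k) *: 'X_k.

Definition schemeL := ideal_gen (minors2 matL).
Definition schemeM := ideal_gen (minors2 matM).
Definition schemeN := ideal_gen (minors2 matN).

Definition degenerate : Prop :=
  exists (x : 'rV[F]_p) (y : 'rV[F]_q) (z : 'rV[F]_r),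
    [/\ x != 0, y != 0 & z != 0] /\
    [/\ forall k, \sum_i \sum_j A (i, j, k) * x 0 i * y 0 j = 0,
        forall j, \sum_i \sum_k A (i, j, k) * x 0 i * z 0 k = 0
      & forall i, \sum_j \sum_k A (i, j, k) * y 0 j * z 0 k = 0].

(* A tensor is represented by its coordinates in the product basis. *)
Definition decomposable (u : 'rV[F]_p) (v : 'rV[F]_q) (w : 'rV[F]_r)
    : hypermatrix F p q r :=
  [ffun t => u 0 t.1.1 * v 0 t.1.2 * w 0 t.2].

Definition sum_of_decomposables (n : nat) : Prop :=
  exists (u : 'I_n -> 'rV[F]_p) (v : 'I_n -> 'rV[F]_q) (w : 'I_n -> 'rV[F]_r),
    A = \sum_(t < n) decomposable (u t) (v t) (w t).

Definition has_tensor_rank (n : nat) : Prop :=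
  sum_of_decomposables n /\ forall m, sum_of_decomposables m -> (n <= m)%N.

Definition trilinear (S : algType F) (x : 'I_p -> S) (y : 'I_q -> S)
    (z : 'I_r -> S) : S :=
  \sum_i \sum_j \sum_k A (i, j, k) *: (x i * y j * z k).

End Hypermatrices.

Section EssentialFormat.
Variables (F : fieldType) (p q r : nat) (A : hypermatrix F p q r).

Definition xvar (i : 'I_p) : {mpoly F[p + q + r]} := 'X_(lshift r (lshift q i)).
Definition yvar (j : 'I_q) : {mpoly F[p + q + r]} := 'X_(lshift r (rshift p j)).
Definition zvar (k : 'I_r) : {mpoly F[p + q + r]} := 'X_(rshift (p + q) k).

(* P_A is a polynomial of degree (1,1,1), with coefficients B, in p' linear
   forms in the x_i, q' in the y_j and r' in the z_k, given by the rows of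
   U, V and W. *)
Definition reducible_to (p' q' r' : nat) : Prop :=
  exists (U : 'M[F]_(p', p)) (V : 'M[F]_(q', q)) (W : 'M[F]_(r', r))
         (B : hypermatrix F p' q' r'),
    trilinear A xvar yvar zvar =
    trilinear B (fun a => \sum_i U a i *: xvar i)
                (fun b => \sum_j V b j *: yvar j)
                (fun c => \sum_k W c k *: zvar k).

Definition has_essential_format (p' q' r' : nat) : Prop :=
  reducible_to p' q' r' /\
  forall p1 q1 r1, reducible_to p1 q1 r1 ->
    [/\ (p' <= p1)%N, (q' <= q1)%N & (r' <= r1)%N].

Definition concise : Prop := has_essential_format p q r.

End EssentialFormat.

Variant case_label :=
  Case1a | Case1b | Case2 | Case3a | Case3b | Case4a | Case4b | Case5a | Case5b.

Definition case_occurs (F : fieldType) (r : nat) (A : hypermatrix F 2 2 r)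
    (c : case_label) : Prop :=
  match c with
  | Case1a => r = 4%N /\ is_smooth_quadric (schemeN A)
  | Case1b => (5 <= r)%N /\ is_cone_over_smooth_quadric 4 (schemeN A)
  | Case2 => is_cone_over_smooth_quadric 3 (schemeN A)
  | Case3a => is_two_hyperplanes (schemeN A) /\ is_hyperplane (schemeL A)
  | Case3b => is_two_hyperplanes (schemeN A) /\ is_two_hyperplanes (schemeL A)
  | Case4a =>
      is_double_hyperplane (schemeN A) /\ is_double_hyperplane (schemeL A)
  | Case4b =>
      is_double_hyperplane (schemeN A) /\
      (forall d, minors2 (matL A) d -> d = 0)
  | Case5a =>
      \det (matN A) = 0 /\
      (is_double_hyperplane (schemeL A) /\ is_whole_space (schemeM A) \/
       is_double_hyperplane (schemeM A) /\ is_whole_space (schemeL A))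
  | Case5b =>
      [/\ \det (matN A) = 0, is_whole_space (schemeL A)
        & is_whole_space (schemeM A)]
  end.

Definition case_conclusion (F : fieldType) (r : nat) (A : hypermatrix F 2 2 r)
    (c : case_label) : Prop :=
  match c with
  | Case1a => [/\ ~ degenerate A, concise A & has_tensor_rank A 4]
  | Case1b => [/\ ~ degenerate A, has_tensor_rank A 4, ~ concise A
                & has_essential_format A 2 2 4]
  | Case2 => [/\ ~ degenerate A, ~ concise A, has_essential_format A 2 2 3
               & has_tensor_rank A 3]
  | Case3a => [/\ degenerate A, has_essential_format A 2 2 3
                & has_tensor_rank A 3]
  | Case3b => [/\ degenerate A, has_essential_format A 2 2 2
                & has_tensor_rank A 2]
  | Case4a => [/\ degenerate A, has_essential_format A 2 2 2
                & has_tensor_rank A 3]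
  | Case4b => [/\ degenerate A, has_essential_format A 2 2 1
                & has_tensor_rank A 2]
  | Case5a => [/\ degenerate A,
                  has_essential_format A 1 2 2 \/ has_essential_format A 2 1 2
                & has_tensor_rank A 2]
  | Case5b => [/\ degenerate A, has_tensor_rank A 1
                & has_essential_format A 1 1 1]
  end.

(* Main.v *)
(* The slices A_ij in F^r of A are the entries of N. Changing coordinates on the
   x_i and y_j, A is brought to one of nine 0/1 tensors by looking at the linear
   relations P between the four slices. Without relation N is generic; a singular
   relation P = u^T v makes the first slice vanish, and the remaining three slices
   are normalized by hand; if all relations are invertible, N becomes symmetric,
   and its three entries are independent because a pencil of relations over an
   algebraically closed field contains a singular one.
   Principal ideals are saturated in at least two variables, so the scheme N
   determines det N up to a scalar, and the rank of this quadratic form separates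
   the groups of cases (1), ..., (5); within a group the cases are separated by r
   or by the ideal of minors of L. *)
Require Import Defs.
From mathcomp Require Import all_boot all_order all_algebra.
From mathcomp Require Import ring.
From Stdlib Require Import Classical.
Set Implicit Arguments.
Unset Strict Implicit.
Unset Printing Implicit Defensive.
Import GRing.Theory Num.Theory.
Local Open Scope ring_scope.

(** No conclusion is ever deduced from the geometry of a case. Each normal form is shown to make one
    case occur and to satisfy its conclusion; since at most one case can occur, any case that occurs
    is that one. A change of coordinates and a reduction to fewer variables are the same operation,
    the substitution [act]. With invertible [U], [V] and a row-free [W], everything reduces to the
    small tensor. Lower bounds come from independence of slices, which gives the essential format,
    and a sum of n decomposables has format at most (n, n, n). This settles every tensor rank but
    that of case (4a), where the format only yields 2; there, two terms would make det N split into
    forms that contradict its being a square. Upper bounds count the ones of the normal form, except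
    in case (2), where four ones hide a rank of 3. The scheme L depends on [U] only as a
    substitution of linear forms, because [V] and [W] preserve the ideal of minors. Case (3a) is the
    only one where that ideal is not saturated. *)

Lemma big_ord2 (V : nmodType) (f : 'I_2 -> V) :
  \sum_(i < 2) f i = f ord0 + f ord_max.
Proof. by rewrite big_ord_recr /= big_ord1; congr (f _ + _); apply: val_inj. Qed.

Lemma ord2P (i : 'I_2) : i = ord0 \/ i = ord_max.
Proof. by case: i => [[|[|//]] h]; [left | right]; apply: val_inj. Qed.

Lemma big_ord3 (V : nmodType) (f : 'I_3 -> V) :
  \sum_(i < 3) f i = f ord0 + f (inord 1) + f ord_max.
Proof.
rewrite !big_ord_recr big_ord0 /= add0r.
by congr (f _ + f _ + _); apply: val_inj; rewrite /= ?inordK.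
Qed.

(** * Substitution of linear forms; essential format and tensor rank under it *)

Section Action.
Variable F : fieldType.

(** Pullback of the trilinear form of [B] along the linear forms in the rows of [U], [V], [W].
    Rectangular matrices are allowed, so that dropping variables is also a pullback. *)
Definition act (p q r p' q' r' : nat) (B : hypermatrix F p' q' r')
    (U : 'M[F]_(p', p)) (V : 'M[F]_(q', q)) (W : 'M[F]_(r', r)) :
    hypermatrix F p q r :=
  [ffun t => \sum_a \sum_b \sum_c
     B (a, b, c) * U a t.1.1 * V b t.1.2 * W c t.2].

(* The sum is abstracted as [X] because, over an [algType], neither [mulr_suml]
   nor [mulr_sumr] matches a sum of scaled terms. *)
Lemma mul_lin_combl (S : algType F) n (c : 'I_n -> F) (x : 'I_n -> S) (X y : S) :
  X = \sum_i c i *: x i -> X * y = \sum_i c i *: (x i * y).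
Proof.
move=> ->; transitivity (\sum_i (c i *: x i) * y); first exact: mulr_suml.
by apply: eq_bigr => i _; rewrite scalerAl.
Qed.

Lemma mul_lin_combr (S : algType F) n (c : 'I_n -> F) (x : 'I_n -> S) (X y : S) :
  X = \sum_i c i *: x i -> y * X = \sum_i c i *: (y * x i).
Proof.
move=> ->; transitivity (\sum_i y * (c i *: x i)); first exact: mulr_sumr.
by apply: eq_bigr => i _; rewrite scalerAr.
Qed.

Lemma mul_lin_comb3 (S : algType F) p q r (b : F) (c : 'I_p -> F)
    (d : 'I_q -> F) (e : 'I_r -> F) (x : 'I_p -> S) (y : 'I_q -> S)
    (z : 'I_r -> S)
    (X Y Z : S) :
  X = \sum_i c i *: x i -> Y = \sum_j d j *: y j -> Z = \sum_k e k *: z k ->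
  b *: (X * Y * Z) =
  \sum_i \sum_j \sum_k (b * c i * d j * e k) *: (x i * y j * z k).
Proof.
move=> eX eY eZ; rewrite -mulrA (mul_lin_combl _ eX) scaler_sumr.
apply: eq_bigr => i _; rewrite mulrA.
rewrite (mul_lin_combl Z (mul_lin_combr (x i) eY)) !scaler_sumr.
apply: eq_bigr => j _.
rewrite (mul_lin_combr _ eZ) !scaler_sumr; apply: eq_bigr => k _.
by rewrite !scalerA.
Qed.

Lemma trilinear_act (S : algType F) p q r p' q' r' (B : hypermatrix F p' q' r')
    (U : 'M[F]_(p', p)) (V : 'M[F]_(q', q)) (W : 'M[F]_(r', r))
    (x : 'I_p -> S) (y : 'I_q -> S) (z : 'I_r -> S) :
  trilinear (act B U V W) x y z =
  trilinear B (fun a => \sum_i U a i *: x i) (fun b => \sum_j V b j *: y j)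
    (fun c => \sum_k W c k *: z k).
Proof.
rewrite /trilinear.
under eq_bigr => i _ do under eq_bigr => j _ do under eq_bigr => k _ do
  (rewrite ffunE scaler_suml; under eq_bigr => a _ do
    (rewrite scaler_suml; under eq_bigr => b _ do rewrite scaler_suml)).
transitivity (\sum_i \sum_j \sum_a \sum_b \sum_c \sum_k
   (B (a, b, c) * U a i * V b j * W c k) *: (x i * y j * z k)).
  apply: eq_bigr => i _; apply: eq_bigr => j _; rewrite exchange_big /=.
  apply: eq_bigr => a _; rewrite exchange_big /=.
  by apply: eq_bigr => b _; rewrite exchange_big.
transitivity (\sum_i \sum_a \sum_b \sum_j \sum_c \sum_k
   (B (a, b, c) * U a i * V b j * W c k) *: (x i * y j * z k)).
  apply: eq_bigr => i _; rewrite exchange_big /=.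
  by apply: eq_bigr => a _; rewrite exchange_big.
rewrite exchange_big /=; apply: eq_bigr => a _; rewrite exchange_big /=.
apply: eq_bigr => b _.
rewrite [LHS](_ : _ = \sum_c \sum_i \sum_j \sum_k
   (B (a, b, c) * U a i * V b j * W c k) *: (x i * y j * z k)); last first.
  rewrite [RHS]exchange_big /=; apply: eq_bigr => i _.
  by rewrite exchange_big.
apply: eq_bigr => c _ /=.
by rewrite (mul_lin_comb3 _ (erefl _) (erefl _) (erefl _)).
Qed.

(** The type [F^o] is [F] as an algebra over itself, which lets [trilinear] be evaluated at
    scalars. *)
Definition unit_vec (n : nat) (i i' : 'I_n) : F^o := (i' == i)%:R.

Lemma sum_unit_vec n (i : 'I_n) (f : 'I_n -> F^o) :
  \sum_i' f i' *: unit_vec i i' = f i.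
Proof.
rewrite (bigD1 i) //= /unit_vec eqxx big1 => [|j /negPf->].
  by rewrite addr0 /GRing.scale /= mulr1.
by rewrite scaler0.
Qed.

Lemma trilinear_unit_vec p q r (A : hypermatrix F p q r) i j k :
  trilinear A (unit_vec i) (unit_vec j) (unit_vec k) = A (i, j, k).
Proof.
rewrite /trilinear (bigD1 i) //= [X in _ + X]big1 => [|i' /negPf ne]; last first.
  by rewrite big1 // => j' _; rewrite big1 // => k' _;
    rewrite /unit_vec ne !mul0r scaler0.
rewrite (bigD1 j) //= [X in _ + X + _]big1 => [|j' /negPf ne]; last first.
  by rewrite big1 // => k' _; rewrite /unit_vec ne mulr0 mul0r scaler0.
rewrite (bigD1 k) //= big1 => [|k' /negPf ne]; last first.
  by rewrite /unit_vec ne mulr0 scaler0.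
by rewrite /unit_vec !eqxx !mulr1 !addr0 /GRing.scale /= mulr1.
Qed.

(** Values at unit vectors are the coefficients. Identities about [act] can thus be checked on
    trilinear forms, where [act] is plain substitution and no sums need to be exchanged. *)
Lemma trilinear_inj p q r (A B : hypermatrix F p q r) :
  (forall x y z, trilinear A x y z = trilinear B x y z :> F^o) -> A = B.
Proof.
by move=> h; apply/ffunP => -[[i j] k]; rewrite -!trilinear_unit_vec h.
Qed.

Lemma eq_trilinear (S : algType F) p q r (A : hypermatrix F p q r)
    (x x' : 'I_p -> S) (y y' : 'I_q -> S) (z z' : 'I_r -> S) :
  x =1 x' -> y =1 y' -> z =1 z' -> trilinear A x y z = trilinear A x' y' z'.
Proof.
move=> ex ey ez; apply: eq_bigr => i _; apply: eq_bigr => j _.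
by apply: eq_bigr => k _; rewrite ex ey ez.
Qed.

Lemma mul_lin_comb (S : lmodType F) m n p (U : 'M[F]_(m, n)) (U' : 'M[F]_(n, p))
    (x : 'I_p -> S) a :
  \sum_b U a b *: (\sum_i U' b i *: x i) = \sum_i (U *m U') a i *: x i.
Proof.
under eq_bigr => b _ do rewrite scaler_sumr.
rewrite exchange_big /=; apply: eq_bigr => i _.
by rewrite mxE scaler_suml; apply: eq_bigr => b _; rewrite scalerA.
Qed.

Lemma act_act p q r p' q' r' p2 q2 r2 (B : hypermatrix F p2 q2 r2)
    (U : 'M[F]_(p2, p')) (V : 'M[F]_(q2, q')) (W : 'M[F]_(r2, r'))
    (U' : 'M[F]_(p', p)) (V' : 'M[F]_(q', q)) (W' : 'M[F]_(r', r)) :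
  act (act B U V W) U' V' W' = act B (U *m U') (V *m V') (W *m W').
Proof.
apply: trilinear_inj => x y z; rewrite !trilinear_act.
by apply: eq_trilinear => t; rewrite mul_lin_comb.
Qed.

Lemma act1 p q r (A : hypermatrix F p q r) : act A 1%:M 1%:M 1%:M = A.
Proof.
apply: trilinear_inj => x y z; rewrite trilinear_act.
by apply: eq_trilinear => t; rewrite (bigD1 t) //= big1 => [|j /negPf ne];
  rewrite !mxE ?eqxx ?scale1r ?addr0 // eq_sym ne scale0r.
Qed.

Lemma reducible_toP p q r (A : hypermatrix F p q r) p' q' r' :
  reducible_to A p' q' r' <->
  exists U V W (B : hypermatrix F p' q' r'), A = act B U V W.
Proof.
split=> -[U [V [W [B e]]]]; exists U, V, W, B; last first.
  by rewrite -trilinear_act -e.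
rewrite -trilinear_act in e; apply: trilinear_inj => x y z.
(* The point whose three blocks of coordinates are x, y and z: evaluating the polynomial identity
   there gives the identity of trilinear forms over [F]. *)
pose v t := row_mx (row_mx (\row_i x i) (\row_j y j)) (\row_k z k) 0 t.
have ev (C : hypermatrix F p q r) :
    (trilinear C (@xvar F p q r) (@yvar F p q r) (@zvar F p q r)).@[v]
    = trilinear C x y z.
  rewrite /trilinear raddf_sum; apply: eq_bigr => i _.
  rewrite raddf_sum; apply: eq_bigr => j _.
  rewrite raddf_sum; apply: eq_bigr => k _.
  rewrite /= mevalZ !mevalM !mevalXU /v.
  by rewrite !row_mxEl !row_mxEr !mxE.
by rewrite -!ev e.
Qed.

Lemma act_decomposable p q r p' q' r' (u : 'rV[F]_p') (v : 'rV[F]_q')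
    (w : 'rV[F]_r') (U : 'M[F]_(p', p)) (V : 'M[F]_(q', q)) (W : 'M[F]_(r', r)) :
  act (decomposable u v w) U V W = decomposable (u *m U) (v *m V) (w *m W).
Proof.
apply/ffunP => t; rewrite !ffunE !mxE /= !mulr_suml; apply: eq_bigr => a _.
rewrite [X in X * _]mulr_sumr mulr_suml; apply: eq_bigr => b _.
rewrite mulr_sumr; apply: eq_bigr => c _; rewrite !ffunE /=; ring.
Qed.

Lemma act_sum p q r p' q' r' n (B : 'I_n -> hypermatrix F p' q' r')
    (U : 'M[F]_(p', p)) (V : 'M[F]_(q', q)) (W : 'M[F]_(r', r)) :
  act (\sum_t B t) U V W = \sum_t act (B t) U V W.
Proof.
apply/ffunP => t; rewrite ffunE sum_ffunE.
under [RHS]eq_bigr do rewrite ffunE.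
rewrite [RHS]exchange_big /=; apply: eq_bigr => a _.
rewrite [RHS]exchange_big /=; apply: eq_bigr => b _.
rewrite [RHS]exchange_big /=; apply: eq_bigr => c _.
by rewrite sum_ffunE !mulr_suml.
Qed.

Lemma sum_of_decomposables_act p q r p' q' r' (B : hypermatrix F p' q' r')
    (U : 'M[F]_(p', p)) (V : 'M[F]_(q', q)) (W : 'M[F]_(r', r)) n :
  sum_of_decomposables B n -> sum_of_decomposables (act B U V W) n.
Proof.
move=> [u [v [w ->]]]; exists (fun t => u t *m U), (fun t => v t *m V).
by exists (fun t => w t *m W); rewrite act_sum; apply: eq_bigr => t _;
  rewrite act_decomposable.
Qed.

(** The factors of the n terms serve as the n linear forms in each direction, and [A] is the
    pullback of the diagonal tensor. Hence every component of the essential format bounds the tensor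
    rank from below. *)
Lemma sum_of_decomposables_reducible p q r (A : hypermatrix F p q r) n :
  sum_of_decomposables A n -> reducible_to A n n n.
Proof.
move=> [u [v [w ->]]]; apply/reducible_toP.
exists (\matrix_t u t), (\matrix_t v t), (\matrix_t w t).
exists (\sum_(t < n) decomposable (delta_mx 0 t) (delta_mx 0 t) (delta_mx 0 t)).
rewrite act_sum; apply: eq_bigr => t _.
by rewrite act_decomposable -!rowE !rowK.
Qed.

(** Conciseness in terms of linear algebra: in each of the three directions the slices are linearly
    independent. *)
Definition slices_free p q r (B : hypermatrix F p q r) : Prop :=
  [/\ forall u : 'rV[F]_p,
        (forall j k, \sum_i u 0 i * B (i, j, k) = 0) -> u = 0,
      forall v : 'rV[F]_q,
        (forall i k, \sum_j v 0 j * B (i, j, k) = 0) -> v = 0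
    & forall w : 'rV[F]_r,
        (forall i j, \sum_k w 0 k * B (i, j, k) = 0) -> w = 0].

Lemma exists_left_kernel m n (M : 'M[F]_(m, n)) :
  (n < m)%N -> exists2 u : 'rV[F]_m, u != 0 & u *m M = 0.
Proof.
move=> lt_nm; have : kermx M != 0.
  rewrite -mxrank_eq0 mxrank_ker subn_eq0 -ltnNge.
  exact: leq_ltn_trans (rank_leq_col M) lt_nm.
case/rowV0Pn => u /sub_kermxP uM u0; by exists u.
Qed.

(** If p1 < p, the p columns of [U] lie in dimension p1 and are dependent; a dependency among them
    is a relation between the slices in the first direction. The other two directions are alike. *)
Lemma slices_free_le p q r p1 q1 r1 (B : hypermatrix F p q r) :
  slices_free B -> reducible_to B p1 q1 r1 ->
  [/\ (p <= p1)%N, (q <= q1)%N & (r <= r1)%N].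
Proof.
move=> [fx fy fz] /reducible_toP[U [V [W [B' e]]]].
split; rewrite leqNgt; apply/negP => lt.
- have [u u0 uU] := exists_left_kernel U^T lt.
  case/eqP: u0; apply: fx => j k; rewrite e.
  have -> : \sum_i u 0 i * act B' U V W (i, j, k) =
    \sum_a \sum_b \sum_c B' (a, b, c) * (u *m U^T) 0 a * V b j * W c k.
    under eq_bigr => i _ do rewrite ffunE mulr_sumr.
    rewrite exchange_big; apply: eq_bigr => a _ /=.
    under eq_bigr => i _ do rewrite mulr_sumr.
    rewrite exchange_big; apply: eq_bigr => b _ /=.
    under eq_bigr => i _ do rewrite mulr_sumr.
    rewrite exchange_big; apply: eq_bigr => c _ /=.
    rewrite mxE mulr_sumr !mulr_suml; apply: eq_bigr => i _.
    by rewrite !mxE /=; ring.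
  rewrite uU; do 3! (rewrite big1 // => ? _); rewrite mxE; ring.
- have [u u0 uU] := exists_left_kernel V^T lt.
  case/eqP: u0; apply: fy => i k; rewrite e.
  have -> : \sum_j u 0 j * act B' U V W (i, j, k) =
    \sum_a \sum_b \sum_c B' (a, b, c) * U a i * (u *m V^T) 0 b * W c k.
    under eq_bigr => j _ do rewrite ffunE mulr_sumr.
    rewrite exchange_big; apply: eq_bigr => a _ /=.
    under eq_bigr => j _ do rewrite mulr_sumr.
    rewrite exchange_big; apply: eq_bigr => b _ /=.
    under eq_bigr => j _ do rewrite mulr_sumr.
    rewrite exchange_big; apply: eq_bigr => c _ /=.
    rewrite mxE mulr_sumr !mulr_suml; apply: eq_bigr => j _.
    by rewrite !mxE /=; ring.
  rewrite uU; do 3! (rewrite big1 // => ? _); rewrite mxE; ring.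
- have [u u0 uU] := exists_left_kernel W^T lt.
  case/eqP: u0; apply: fz => i j; rewrite e.
  have -> : \sum_k u 0 k * act B' U V W (i, j, k) =
    \sum_a \sum_b \sum_c B' (a, b, c) * U a i * V b j * (u *m W^T) 0 c.
    under eq_bigr => k _ do rewrite ffunE mulr_sumr.
    rewrite exchange_big; apply: eq_bigr => a _ /=.
    under eq_bigr => k _ do rewrite mulr_sumr.
    rewrite exchange_big; apply: eq_bigr => b _ /=.
    under eq_bigr => k _ do rewrite mulr_sumr.
    rewrite exchange_big; apply: eq_bigr => c _ /=.
    rewrite mxE mulr_sumr; apply: eq_bigr => k _.
    by rewrite !mxE /=; ring.
  rewrite uU; do 3! (rewrite big1 // => ? _); rewrite mxE; ring.
Qed.

(** Row-free matrices have right inverses, and pulling back along these recovers [B]. So [B] and its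
    pullback are reducible to each other. *)
Lemma act_inv p q r p' q' r' (B : hypermatrix F p' q' r')
    (U : 'M[F]_(p', p)) (V : 'M[F]_(q', q)) (W : 'M[F]_(r', r)) :
  row_free U -> row_free V -> row_free W ->
  exists U' V' W', B = act (act B U V W) U' V' W'.
Proof.
move=> /row_freeP[U' eU] /row_freeP[V' eV] /row_freeP[W' eW].
by exists U', V', W'; rewrite act_act eU eV eW act1.
Qed.

Lemma essential_format_act p q r p' q' r' (B : hypermatrix F p' q' r')
    (U : 'M[F]_(p', p)) (V : 'M[F]_(q', q)) (W : 'M[F]_(r', r)) :
  row_free U -> row_free V -> row_free W -> slices_free B ->
  has_essential_format (act B U V W) p' q' r'.
Proof.
move=> fU fV fW fB; split; first by apply/reducible_toP; exists U, V, W, B.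
move=> p1 q1 r1 /reducible_toP[U1 [V1 [W1 [B1 e]]]].
apply: slices_free_le fB _; apply/reducible_toP.
have [U' [V' [W' ->]]] := act_inv B fU fV fW.
by rewrite e act_act; do 4 eexists.
Qed.

Lemma has_tensor_rank_max p q r p' q' r' (A : hypermatrix F p q r) n :
  has_essential_format A p' q' r' ->
  sum_of_decomposables A n -> (n <= maxn p' (maxn q' r'))%N ->
  has_tensor_rank A n.
Proof.
move=> [_ ess] sA le_n; split=> // m /sum_of_decomposables_reducible/ess[h1 h2 h3].
by apply: leq_trans le_n _; rewrite !geq_max h1 h2.
Qed.

End Action.

Arguments unit_vec {F n}.

Ltac expand_act :=
  rewrite !ffunE !big_ord2 ?big_ord_recl ?big_ord0 !ffunE /= !mxE /=.

(** * The nine normal forms, and tensors whose first slice vanishes *)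

Section NormalForms.
Variable F : numClosedFieldType.

(** The list [e] holds the positions of the ones. With explicit positions, independence of slices
    becomes a computation, and a duplicate-free [e] is itself a decomposition into [size e]
    terms. *)
Definition core (p q s : nat) (e : seq (nat * nat * nat)) : hypermatrix F p q s :=
  [ffun t => ((val t.1.1, val t.1.2, val t.2) \in e)%:R].

Definition core1 := core 2 2 4 [:: (0, 0, 0); (0, 1, 1); (1, 0, 2); (1, 1, 3)]%N.
Definition core2 := core 2 2 3 [:: (0, 0, 0); (0, 1, 1); (1, 0, 1); (1, 1, 2)]%N.
Definition core3a := core 2 2 3 [:: (0, 1, 0); (1, 0, 1); (1, 1, 2)]%N.
Definition core3b := core 2 2 2 [:: (0, 1, 0); (1, 0, 1)]%N.
Definition core4a := core 2 2 2 [:: (0, 1, 0); (1, 0, 0); (1, 1, 1)]%N.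
Definition core4b := core 2 2 1 [:: (0, 1, 0); (1, 0, 0)]%N.
Definition core5a := core 2 2 2 [:: (1, 0, 0); (1, 1, 1)]%N.
Definition core5a' := core 2 2 2 [:: (0, 1, 0); (1, 1, 1)]%N.
Definition core5b := core 2 2 1 [:: (1, 1, 0)]%N.

(** [W] is only row-free: s independent linear forms in the r variables z, the remaining directions
    being invisible to [A]. *)
Definition has_form r s (A : hypermatrix F 2 2 r) (B : hypermatrix F 2 2 s) :=
  exists (U V : 'M_2) (W : 'M_(s, r)),
    [/\ U \in unitmx, V \in unitmx, row_free W & A = act B U V W].

Lemma has_form_act r s (A : hypermatrix F 2 2 r) (B : hypermatrix F 2 2 s)
    (U V : 'M_2) :
  U \in unitmx -> V \in unitmx ->
  has_form (act A U V 1%:M) B -> has_form A B.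
Proof.
move=> uU uV [U' [V' [W [uU' uV' fW e]]]].
exists (U' *m invmx U), (V' *m invmx V), W.
split; rewrite ?unitmx_mul ?uU' ?uV' ?unitmx_inv //.
have -> : A = act (act A U V 1%:M) (invmx U) (invmx V) 1%:M.
  by rewrite act_act !mulmxV // mulmx1 act1.
by rewrite e act_act mulmx1.
Qed.

Definition mx2 (a b c d : F) : 'M_2 :=
  \matrix_(i, j) nth 0 (nth [::] [:: [:: a; b]; [:: c; d]] i) j.

Lemma mx2_unit a b c d : a * d - b * c != 0 -> mx2 a b c d \in unitmx.
Proof.
move=> nz; rewrite unitmxE unitfE (expand_det_row _ ord0) big_ord2.
by rewrite /cofactor !det_mx11 !mxE /= expr0 expr1 mul1r mulN1r mulrN.
Qed.

Definition slice r (A : hypermatrix F 2 2 r) i j : 'rV_r := \row_k A (i, j, k).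

Lemma hypermatrix22P r (A B : hypermatrix F 2 2 r) :
  (forall k, [/\ A (ord0, ord0, k) = B (ord0, ord0, k),
                 A (ord0, ord_max, k) = B (ord0, ord_max, k),
                 A (ord_max, ord0, k) = B (ord_max, ord0, k)
               & A (ord_max, ord_max, k) = B (ord_max, ord_max, k)]) -> A = B.
Proof.
move=> h; apply/ffunP => -[[i j] k]; have [? ? ? ?] := h k.
by case: (ord2P i) => ->; case: (ord2P j) => ->.
Qed.

Definition rows (r s : nat) (ws : seq 'rV[F]_r) : 'M_(s, r) :=
  \matrix_(c < s) nth 0 ws c.

Lemma rows_free r s (ws : seq 'rV[F]_r) :
  (forall u : 'rV_s, \sum_c u 0 c *: nth 0 ws c = 0 -> forall c, u 0 c = 0) ->
  row_free (rows s ws).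
Proof.
move=> h; apply: inj_row_free => u u0; apply/rowP => c; rewrite mxE.
apply: h; rewrite -[RHS]u0 mulmx_sum_row.
by apply: eq_bigr => i _; rewrite rowK.
Qed.

Lemma rows1_free r (b : 'rV[F]_r) : b != 0 -> row_free (rows 1 [:: b]).
Proof.
move=> b0; apply: rows_free => u; rewrite big_ord1 => /eqP.
rewrite scaler_eq0 (negPf b0) orbF => /eqP e c.
by rewrite (ord1 c).
Qed.

Lemma rows2_free r (b d : 'rV[F]_r) :
  b != 0 -> ~~ (d <= b)%MS -> row_free (rows 2 [:: b; d]).
Proof.
move=> b0 nd; apply: rows_free => u; rewrite big_ord2 /= => e.
have u1 : u 0 ord_max = 0.
  apply/eqP; apply: contraNT nd => u1; apply/sub_rVP.
  exists (- (u 0 ord_max)^-1 * u 0 ord0).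
  apply: (scalerI u1); rewrite scalerA mulrA mulrN divff // mulN1r scaleNr.
  by apply/eqP; rewrite -addr_eq0 addrC e.
move: e; rewrite u1 scale0r addr0 => /eqP; rewrite scaler_eq0 (negPf b0) orbF.
move=> /eqP u0 [[|[|//]] h]; [rewrite -u0|rewrite -u1]; congr (u 0 _);
  exact: val_inj.
Qed.

Lemma rows3_free r (b c d : 'rV[F]_r) :
  b != 0 -> ~~ (c <= b)%MS -> ~~ (d <= b + c)%MS ->
  row_free (rows 3 [:: b; c; d]).
Proof.
move=> b0 nc nd; apply: rows_free => u; rewrite big_ord3 /= inordK // => e.
have u2 : u 0 ord_max = 0.
  apply/eqP; apply: contraNT nd => u2.
  have -> : d = (- (u 0 ord_max)^-1 * u 0 ord0) *: b +
                (- (u 0 ord_max)^-1 * u 0 (inord 1)) *: c.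
    apply: (scalerI u2); rewrite scalerDr !scalerA !mulrA !mulrN !divff // !mulN1r.
    by apply/eqP; rewrite !scaleNr -opprD -addr_eq0 addrC e.
  by rewrite addmx_sub_adds ?scalemx_sub.
move: e; rewrite u2 scale0r addr0 => e.
have := rows2_free b0 nc; rewrite -kermx_eq0 => /eqP K.
have : (\row_i nth 0 [:: u 0 ord0; u 0 (inord 1)] i <= kermx (rows 2 [:: b; c]))%MS.
  apply/sub_kermxP; rewrite mulmx_sum_row big_ord2 !rowK !mxE /=; exact: e.
rewrite K submx0 => /eqP/rowP h.
move: (h ord0) (h ord_max); rewrite !mxE /= => u0 u1.
move=> [[|[|[|//]]] lt]; [rewrite -u0|rewrite -u1|rewrite -u2]; congr (u 0 _);
  by apply: val_inj; rewrite /= ?inordK.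
Qed.

Lemma act_core_form r s e (A : hypermatrix F 2 2 r) (U V : 'M_2) ws :
  U \in unitmx -> V \in unitmx -> row_free (rows s ws) ->
  A = act (core 2 2 s e) U V (rows s ws) -> has_form A (core 2 2 s e).
Proof. by move=> uU uV fW ->; exists U, V, (rows s ws). Qed.

(** What distinguishes the outcomes is the position of the slices b, c, d: which of b and c vanish,
    whether c is a multiple of b, and whether d lies in their span. In the last case d is absorbed
    by a change of x and y, otherwise it becomes a new coordinate. *)
Lemma classification_corner r (A : hypermatrix F 2 2 r) :
  slice A ord0 ord0 = 0 -> A <> 0 ->
  has_form A core3a \/ has_form A core3b \/ has_form A core4a \/
  has_form A core4b \/ has_form A core5a \/ has_form A core5a' \/
  has_form A core5b.
Proof.
move=> a0 nzA.
have A00 k : A (ord0, ord0, k) = 0 by move/rowP/(_ k): a0; rewrite !mxE.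
set b := slice A ord0 ord_max; set c := slice A ord_max ord0.
set d := slice A ord_max ord_max.
have A01 k : A (ord0, ord_max, k) = b 0 k by rewrite !mxE.
have A10 k : A (ord_max, ord0, k) = c 0 k by rewrite !mxE.
have A11 k : A (ord_max, ord_max, k) = d 0 k by rewrite !mxE.
have u1 : (1%:M : 'M[F]_2) \in unitmx by rewrite unitmx1.
move: A01 A10 A11; clearbody b c d => A01 A10 A11.
have [b0|b0] := eqVneq b 0.
  have [c0|c0] := eqVneq c 0.
    have d0 : d != 0.
      apply/eqP => d0; case: nzA; apply: hypermatrix22P => k.
      by rewrite A00 A01 A10 A11 b0 c0 d0 !ffunE !mxE.
    do 6 right; apply: (act_core_form (ws := [:: d]) u1 u1).
      exact: rows1_free.
    apply: hypermatrix22P => k; rewrite A00 A01 A10 A11 b0 c0.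
    by expand_act; split; ring.
  have [/sub_rVP[x dx]|nd] := boolP (d <= c)%MS.
    (* The only nonzero row of N is (c, x c), that is, c times one linear form in y with
       coefficients (1, x); this form is the second row of [V]. *)
    do 6 right; have uV : mx2 0 1 1 x \in unitmx.
      by apply: mx2_unit; rewrite mul0r sub0r mul1r oppr_eq0 oner_neq0.
    apply: (act_core_form (ws := [:: c]) u1 uV); first exact: rows1_free.
    apply: hypermatrix22P => k; rewrite A00 A01 A10 A11 b0 dx.
    by expand_act; split; ring.
  do 4 right; left; apply: (act_core_form (ws := [:: c; d]) u1 u1).
    exact: rows2_free.
  apply: hypermatrix22P => k; rewrite A00 A01 A10 A11 b0.
  by expand_act; split; ring.
have [c0|c0] := eqVneq c 0.
  have [/sub_rVP[x dx]|nd] := boolP (d <= b)%MS.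
    do 6 right; have uU : mx2 0 1 1 x \in unitmx.
      by apply: mx2_unit; rewrite mul0r sub0r mul1r oppr_eq0 oner_neq0.
    apply: (act_core_form (ws := [:: b]) uU u1); first exact: rows1_free.
    apply: hypermatrix22P => k; rewrite A00 A01 A10 A11 c0 dx.
    by expand_act; split; ring.
  do 5 right; left; apply: (act_core_form (ws := [:: b; d]) u1 u1).
    exact: rows2_free.
  apply: hypermatrix22P => k; rewrite A00 A01 A10 A11 c0.
  by expand_act; split; ring.
have [/sub_rVP[x cx]|nc] := boolP (c <= b)%MS.
  have x0 : x != 0 by apply: contraNneq c0 => x0; rewrite cx x0 scale0r.
  have [/sub_rVP[y dy]|nd] := boolP (d <= b)%MS.
    do 3 right; left; have uU : mx2 1 y 0 x \in unitmx.
      by apply: mx2_unit; rewrite mulr0 subr0 mul1r.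
    apply: (act_core_form (ws := [:: b]) uU u1); first exact: rows1_free.
    apply: hypermatrix22P => k; rewrite A00 A01 A10 A11 cx dy.
    by expand_act; split; ring.
  do 2 right; left; have uV : mx2 x 0 0 1 \in unitmx.
    by apply: mx2_unit; rewrite mulr0 subr0 mulr1.
  apply: (act_core_form (ws := [:: b; d]) u1 uV); first exact: rows2_free.
  apply: hypermatrix22P => k; rewrite A00 A01 A10 A11 cx.
  by expand_act; split; ring.
have [/sub_addsmxP[[p q] /= dpq]|nd] := boolP (d <= b + c)%MS.
  (* With d = p b + q c, one shear in x creates the summand p b and one shear in y the summand q c
     of the last slice, while the slices b and c stay in place. *)
  right; left; have uU : mx2 1 (p 0 0) 0 1 \in unitmx.
    by apply: mx2_unit; rewrite mulr0 subr0 mulr1 oner_neq0.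
  have uV : mx2 1 (q 0 0) 0 1 \in unitmx.
    by apply: mx2_unit; rewrite mulr0 subr0 mulr1 oner_neq0.
  apply: (act_core_form (ws := [:: b; c]) uU uV); first exact: rows2_free.
  apply: hypermatrix22P => k; rewrite A00 A01 A10 A11 dpq !mulmx_sum_row.
  rewrite !big_ord1 !row_id.
  by expand_act; split; ring.
left; apply: (act_core_form (ws := [:: b; c; d]) u1 u1); first exact: rows3_free.
apply: hypermatrix22P => k; rewrite A00 A01 A10 A11.
by expand_act; split; ring.
Qed.

End NormalForms.

Arguments core {F}.
Arguments core1 {F}.
Arguments core2 {F}.
Arguments core3a {F}.
Arguments core3b {F}.
Arguments core4a {F}.
Arguments core4b {F}.
Arguments core5a {F}.
Arguments core5a' {F}.
Arguments core5b {F}.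

(** * Linear relations between the four slices, and the classification *)

Section Classification.
Variable F : numClosedFieldType.

(** The coefficients form a matrix because changes of x and y act on it by [U *m P *m V^T], so that
    being singular is independent of the coordinates. *)
Definition slice_relation r (A : hypermatrix F 2 2 r) (P : 'M_2) : Prop :=
  \sum_i \sum_j P i j *: slice A i j = 0.

Lemma slice_act r (A : hypermatrix F 2 2 r) (U V : 'M_2) a b :
  slice (act A U V 1%:M) a b = \sum_i \sum_j (U i a * V j b) *: slice A i j.
Proof.
apply/rowP => k; rewrite !mxE ffunE /= summxE; apply: eq_bigr => i _.
rewrite summxE; apply: eq_bigr => j _.
rewrite (bigD1 k) //= big1 => [|k' /negPf ne]; rewrite !mxE ?eqxx ?ne ?mulr0 //.
by rewrite /=; ring.
Qed.

Lemma slice_relation_act r (A : hypermatrix F 2 2 r) (U V P : 'M_2) :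
  slice_relation (act A U V 1%:M) P -> slice_relation A (U *m P *m V^T).
Proof.
rewrite /slice_relation => e; rewrite -[RHS]e.
apply/rowP => k; rewrite !big_ord2 !slice_act !big_ord2.
do 4! rewrite ?mxE ?big_ord2; ring.
Qed.

Lemma complete_row (u : 'rV[F]_2) :
  u != 0 -> exists2 U : 'M_2, U \in unitmx & forall i, U i ord0 = u 0 i.
Proof.
move=> u0; have [z|nz] := eqVneq (u 0 ord0) 0; last first.
  exists (mx2 (u 0 ord0) 0 (u 0 ord_max) 1).
    by apply: mx2_unit; rewrite mul0r subr0 mulr1.
  by move=> i; case: (ord2P i) => ->; rewrite !mxE.
exists (mx2 (u 0 ord0) 1 (u 0 ord_max) 0); last first.
  by move=> i; case: (ord2P i) => ->; rewrite !mxE.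
apply: mx2_unit; rewrite mulr0 sub0r mul1r oppr_eq0.
apply: contraNneq u0 => z1; apply/eqP/rowP => i; rewrite mxE.
by case: (ord2P i) => ->.
Qed.

Lemma det_mx22 (R : comNzRingType) (P : 'M[R]_2) :
  \det P = P ord0 ord0 * P ord_max ord_max - P ord0 ord_max * P ord_max ord0.
Proof.
rewrite (expand_det_row _ ord0) big_ord2 /cofactor !det_mx11 !mxE /=.
rewrite expr0 expr1 mul1r mulN1r mulrN.
by congr (_ * P _ _ - _ * P _ _); apply: val_inj.
Qed.

Lemma singular_mx22 (P : 'M[F]_2) :
  P != 0 -> \det P = 0 ->
  exists u v : 'rV_2, [/\ u != 0, v != 0 & forall i j, P i j = u 0 i * v 0 j].
Proof.
move=> P0 dP; have rP : \rank P = 1%N.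
  apply/eqP; rewrite eqn_leq lt0n mxrank_eq0 P0 andbT -ltnS ltn_neqAle rank_leq_row.
  rewrite andbT; apply: contra_eq_neq dP => /eqP fP.
  by rewrite -unitfE -unitmxE -row_free_unit /row_free fP.
have := mulmx_base P; move: (col_base P) (row_base P); rewrite rP => C R e.
exists C^T, R; split.
- by apply: contraNneq P0 => C0; rewrite -e -[C]trmxK C0 trmx0 mul0mx.
- by apply: contraNneq P0 => R0; rewrite -e R0 mulmx0.
- by move=> i j; rewrite -e !mxE big_ord1.
Qed.

Lemma act_neq0 r (A : hypermatrix F 2 2 r) (U V : 'M_2) :
  U \in unitmx -> V \in unitmx -> A <> 0 -> act A U V 1%:M <> 0.
Proof.
move=> uU uV nzA e; apply: nzA.
have -> : A = act (act A U V 1%:M) (invmx U) (invmx V) 1%:M.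
  by rewrite act_act !mulmxV // mulmx1 act1.
rewrite e; apply/ffunP => t; rewrite !ffunE.
by do 3! (rewrite big1 // => ? _); rewrite ffunE !mul0r.
Qed.

(** The quadratic formula for t^2 + b t + c; algebraic closedness enters through the square root of
    the discriminant. *)
Lemma root_quadratic (b c : F) : exists t : F, t * (b + t) + c = 0.
Proof.
exists ((2.-root (b ^+ 2 - 4%:R * c) - b) / 2%:R).
have := sqrtCK (b ^+ 2 - 4%:R * c); move: (2.-root _) => s es.
have -> : (s - b) / 2%:R * (b + (s - b) / 2%:R) + c =
  (s ^+ 2 - (b ^+ 2 - 4%:R * c)) / 4%:R by field.
by rewrite es subrr mul0r.
Qed.

Theorem classification r (A : hypermatrix F 2 2 r) : A <> 0 ->
  has_form A core1 \/ has_form A core2 \/ has_form A core3a \/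
  has_form A core3b \/ has_form A core4a \/ has_form A core4b \/
  has_form A core5a \/ has_form A core5a' \/ has_form A core5b.
Proof.
move=> nzA.
have u1 : (1%:M : 'M[F]_2) \in unitmx by rewrite unitmx1.
case: (classic (exists P, [/\ P != 0, \det P = 0 & slice_relation A P])).
  move=> [P [P0 dP rP]]; do 2 right.
  (* Completing u and v to first columns of invertible [U] and [V] makes the first slice of the
     transformed tensor equal to the left-hand side of the relation [P]. *)
  have [u [v [u0 v0 euv]]] := singular_mx22 P0 dP.
  have [U uU eU] := complete_row u0; have [V uV eV] := complete_row v0.
  have a0 : slice (act A U V 1%:M) ord0 ord0 = 0.
    rewrite slice_act -[RHS]rP; apply: eq_bigr => i _; apply: eq_bigr => j _.
    by rewrite eU eV euv.
  have := classification_corner a0 (act_neq0 uU uV nzA).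
  by do 6?[case=> [/(has_form_act uU uV)|]; [tauto|]];
    move/(has_form_act uU uV); tauto.
move=> nosing.
case: (classic (exists2 P, P != 0 & slice_relation A P)) => [[P P0 rP]|norel].
  right; left.
  have dP : \det P != 0 by apply: contra_notN nosing => /eqP dP; exists P.
  (* With this U, the entry 01 minus the entry 10 of N is the relation P. *)
  pose U := mx2 (P ord0 ord_max) (- P ord0 ord0) (P ord_max ord_max)
    (- P ord_max ord0).
  have uU : U \in unitmx.
    apply: mx2_unit; apply: contraNneq dP => e.
    by apply/eqP; rewrite det_mx22 -[RHS]e; ring.
  apply: (has_form_act uU u1); set A' := act A U _ _.
  (* Since [U] is invertible, [Q] and [U *m Q] vanish together, and [U *m Q] is singular when [Q]
     is. *)
  have nosing' Q : slice_relation A' Q -> \det Q = 0 -> Q = 0.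
    move=> /slice_relation_act; rewrite trmx1 mulmx1 => rQ dQ.
    apply/eqP; apply: contra_notT nosing => Q0; exists (U *m Q); split=> //.
      apply: contraNneq Q0 => UQ; rewrite -[Q]mul1mx -(mulVmx uU) -mulmxA UQ.
      by rewrite mulmx0.
    by rewrite det_mulmx dQ mulr0.
  have e01 : slice A' ord0 ord_max = slice A' ord_max ord0.
    apply/eqP; rewrite -subr_eq0 -[X in _ == X]rP !slice_act !big_ord2 !mxE /=.
    by apply/eqP/rowP => k; rewrite !mxE; ring.
  apply: (act_core_form u1 u1
    (ws := [:: slice A' ord0 ord0; slice A' ord0 ord_max;
               slice A' ord_max ord_max])).
    apply: rows_free => u; rewrite big_ord3 /= inordK // => e.
    (* By e01, adding t and -t off the diagonal preserves the relation. *)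
    pose Q t := mx2 (u 0 ord0) (u 0 (inord 1) + t) (- t) (u 0 ord_max).
    have rQ t : slice_relation A' (Q t).
      rewrite /slice_relation !big_ord2 !mxE /= -e01 -[RHS]e.
      by apply/rowP => k; rewrite !mxE; ring.
    (* The determinant of [Q t] is u_0 u_2 + t (u_1 + t). At a root t the relation is singular,
       hence zero, which forces t = 0 and then u = 0. *)
    have [t et] := root_quadratic (u 0 (inord 1)) (u 0 ord0 * u 0 ord_max).
    have dQ : \det (Q t) = 0.
      by rewrite det_mx22 !mxE /= -[RHS]et; ring.
    have /matrixP Q0 := nosing' _ (rQ t) dQ.
    move: (Q0 ord0 ord0) (Q0 ord0 ord_max) (Q0 ord_max ord0) (Q0 ord_max ord_max).
    rewrite !mxE /= => h0 h1 /eqP; rewrite oppr_eq0 => /eqP t0 h2.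
    rewrite t0 addr0 in h1.
    by move=> [[|[|[|//]]] lt]; [rewrite -h0|rewrite -h1|rewrite -h2];
      congr (u 0 _); apply: val_inj; rewrite /= ?inordK.
  move: e01 => /rowP; clearbody A' => e01.
  apply: hypermatrix22P => k; have := e01 k; rewrite !mxE => ek.
  by expand_act; rewrite -?ek; split; ring.
left; apply: (act_core_form u1 u1
  (ws := [:: slice A ord0 ord0; slice A ord0 ord_max; slice A ord_max ord0;
             slice A ord_max ord_max])).
  apply: rows_free => u e.
  (* The index [2 * i + j] is the position of the slice (i, j) in the list [ws]. *)
  pose P := \matrix_(i < 2, j < 2) u 0 (inord (2 * i + j)).
  have rP : slice_relation A P.
    rewrite /slice_relation -[RHS]e !big_ord2 !mxE /= big_ord_recr big_ord3 /=.
    rewrite !inordK // addrA.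
    by congr (_ *: _ + _ *: _ + _ *: _ + _ *: _); congr (u 0 _);
      apply: val_inj; rewrite /= !inordK.
  have P0 : P = 0.
    by apply/eqP; apply: contra_notT norel => P0; exists P.
  move/matrixP: P0 => P0; rewrite /P in P0.
  move: (P0 ord0 ord0) (P0 ord0 ord_max) (P0 ord_max ord0) (P0 ord_max ord_max).
  rewrite !mxE /= => h0 h1 h2 h3.
  move=> [[|[|[|[|//]]]] lt]; [rewrite -h0|rewrite -h1|rewrite -h2|rewrite -h3];
    by congr (u 0 _); apply: val_inj; rewrite /= inordK.
by apply: hypermatrix22P => k; expand_act; split; ring.
Qed.
End Classification.

(** * Principal ideals, saturation and linear forms *)

Section Ideals.
Variables (F : fieldType) (n : nat).
Implicit Types (f g q : {mpoly F[n]}) (S T I J : {mpoly F[n]} -> Prop).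

Lemma ideal_gen_sum S m (g h : 'I_m -> {mpoly F[n]}) :
  (forall t, S (h t)) -> ideal_gen S (\sum_t g t * h t).
Proof. by move=> Sh; exists m, g, h. Qed.

Lemma ideal_genM S f g : S f -> ideal_gen S (g * f).
Proof.
by move=> Sf; exists 1%N, (fun=> g), (fun=> f); rewrite big_ord1.
Qed.

Lemma ideal_gen0 S : ideal_gen S 0.
Proof. by exists 0%N, (fun=> 0), (fun=> 0); split; [case|rewrite big_ord0]. Qed.

Lemma ideal_genD S f g : ideal_gen S f -> ideal_gen S g -> ideal_gen S (f + g).
Proof.
move=> [m [a [h [Sh ->]]]] [m' [a' [h' [Sh' ->]]]].
exists (m + m')%N, (fun t => match split t with inl u => a u | inr u => a' u end),
  (fun t => match split t with inl u => h u | inr u => h' u end); split.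
  by move=> t; case: split.
rewrite big_split_ord /=; congr (_ + _); apply: eq_bigr => t _.
  by rewrite (unsplitK (inl _ t)).
by rewrite (unsplitK (inr _ t)).
Qed.

Lemma ideal_gen_mull S f g : ideal_gen S f -> ideal_gen S (g * f).
Proof.
move=> [m [a [h [Sh ->]]]]; rewrite mulr_sumr.
under eq_bigr do rewrite mulrA.
exact: ideal_gen_sum.
Qed.

Lemma ideal_gen_bigD S (T : finType) (f : T -> {mpoly F[n]}) :
  (forall t, ideal_gen S (f t)) -> ideal_gen S (\sum_t f t).
Proof.
by move=> h; elim/big_ind: _ => //; [exact: ideal_gen0 | exact: ideal_genD].
Qed.

Lemma ideal_gen_sub S T f :
  (forall h, S h -> ideal_gen T h) -> ideal_gen S f -> ideal_gen T f.
Proof.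
move=> ST [m [a [h [Sh ->]]]]; apply: ideal_gen_bigD => t.
by apply: ideal_gen_mull; apply: ST.
Qed.

Lemma principalP q f : principal q f <-> exists g, f = g * q.
Proof.
split=> [[m [a [h [Sh ->]]]]|[g ->]]; last exact: ideal_genM.
by exists (\sum_t a t); rewrite mulr_suml; apply: eq_bigr => t _; rewrite Sh.
Qed.

Lemma principal_id q : principal q q.
Proof. by apply/principalP; exists 1; rewrite mul1r. Qed.

Lemma same_scheme_sym I J : same_scheme I J -> same_scheme J I.
Proof. by move=> h f; symmetry. Qed.

Lemma same_scheme_trans I J K :
  same_scheme I J -> same_scheme J K -> same_scheme I K.
Proof. by move=> h h' f; rewrite h. Qed.

Lemma eq_same_scheme I J : (forall f, I f <-> J f) -> same_scheme I J.
Proof. by move=> h f; split=> s i; have [m] := s i; exists m; apply/h. Qed.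

Lemma linear_formD (c d : 'rV[F]_n) :
  linear_form (c + d) = linear_form c + linear_form d.
Proof.
rewrite /linear_form -big_split; apply: eq_bigr => i _.
by rewrite mxE scalerDl.
Qed.

Lemma linear_formZ k (c : 'rV[F]_n) : linear_form (k *: c) = k *: linear_form c.
Proof.
by rewrite /linear_form scaler_sumr; apply: eq_bigr => i _; rewrite mxE scalerA.
Qed.

Lemma linear_form0 : linear_form 0 = 0 :> {mpoly F[n]}.
Proof. by rewrite -[0 in LHS](scale0r 0) linear_formZ scale0r. Qed.

Lemma linear_form_sum (T : finType) (c : T -> 'rV[F]_n) :
  linear_form (\sum_t c t) = \sum_t linear_form (c t).
Proof. exact: (big_morph _ linear_formD linear_form0). Qed.

Lemma linear_form_delta i : linear_form (delta_mx 0 i) = 'X_i :> {mpoly F[n]}.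
Proof.
rewrite /linear_form (bigD1 i) //= big1 => [|j /negPf ne].
  by rewrite mxE !eqxx scale1r addr0.
by rewrite mxE ne andbF scale0r.
Qed.

Lemma meval_linear_form (c : 'rV[F]_n) v :
  (linear_form c).@[v] = \sum_i c 0 i * v i.
Proof.
rewrite /linear_form raddf_sum; apply: eq_bigr => i _.
by rewrite /= mevalZ mevalXU.
Qed.

Lemma linear_form_inj : injective (@linear_form F n).
Proof.
move=> c d e; apply/rowP => i.
have ev b : (linear_form b).@[fun j => (j == i)%:R : F] = b 0 i.
  rewrite meval_linear_form (bigD1 i) //= eqxx mulr1 big1 ?addr0 // => j.
  by move/negPf ->; rewrite mulr0.
by rewrite -!ev e.
Qed.

Lemma linear_form_eq0 (c : 'rV[F]_n) : (linear_form c == 0) = (c == 0).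
Proof. by rewrite -linear_form0 (inj_eq linear_form_inj). Qed.

(* Substituting for X_j its value on the hyperplane c = 0 is a retraction of
   the polynomial ring whose kernel is the ideal of the hyperplane. *)
Definition hyperplane_subst (c : 'rV[F]_n) (j : 'I_n) : n.-tuple {mpoly F[n]} :=
  [tuple 'X_i - ((i == j)%:R / c 0 j) *: linear_form c | i < n].

Lemma principal_linear_form (c : 'rV[F]_n) j f :
  c 0 j != 0 ->
  principal (linear_form c) f <-> f \mPo hyperplane_subst c j = 0.
Proof.
move=> cj; split=> [/principalP[g ->]|e].
  rewrite rmorphM /= [X in _ * X](_ : _ = 0) ?mulr0 //.
  rewrite /linear_form raddf_sum /=.
  under eq_bigr => i _ do
    rewrite comp_mpolyZ comp_mpolyXU -tnth_nth tnth_mktuple scalerBr scalerA.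
  rewrite big_split /= -[X in X + _]/(linear_form c) sumrN -scaler_suml.
  rewrite (bigD1 j) //= eqxx big1 ?addr0 => [|i /negPf ->]; last first.
    by rewrite mul0r mulr0.
  by rewrite mul1r mulfV // scale1r subrr.
(* Every f is congruent to its image under the substitution: congruence modulo the ideal respects
   sums and products, and each variable differs from its image by a multiple of the linear form. *)
rewrite -[f]subr0 -e; elim/mpolyind: f {e} => [|k m f _ _ IH].
  by rewrite comp_mpoly0 subr0; exact: ideal_gen0.
rewrite comp_mpolyD comp_mpolyZ opprD addrACA -scalerBr.
apply: ideal_genD => //; rewrite -mul_mpolyC; apply: ideal_gen_mull.
rewrite comp_mpolyX mpolyXE_id.
suff H (x y x' y' : {mpoly F[n]}) : principal (linear_form c) (x - y) ->
    principal (linear_form c) (x' - y') ->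
    principal (linear_form c) (x * x' - y * y').
  elim/big_ind2: _ => [|x y x' y' /H h /h //|i _]; last first.
    elim: (m i) => [|p IHp]; first by rewrite subrr; exact: ideal_gen0.
    rewrite !exprS; apply: H IHp; rewrite tnth_mktuple opprB addrCA subrr addr0.
    by rewrite -mul_mpolyC; apply/principalP; eexists.
  by rewrite subrr; exact: ideal_gen0.
move=> h h'; rewrite (_ : _ - _ = x' * (x - y) + y * (x' - y')); last by ring.
by apply: ideal_genD; apply: ideal_gen_mull.
Qed.

Lemma rV_neq0 (c : 'rV[F]_n) : c != 0 -> exists j, c 0 j != 0.
Proof. by case/rV0Pn => j; exists j. Qed.

(** The ideal is the kernel of a ring morphism to an integral domain. *)
Lemma linear_form_prime (c : 'rV[F]_n) f g : c != 0 ->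
  principal (linear_form c) (f * g) ->
  principal (linear_form c) f \/ principal (linear_form c) g.
Proof.
move=> /rV_neq0[j cj]; rewrite !(principal_linear_form _ cj) rmorphM /=.
by move=> /eqP; rewrite mulf_eq0 => /orP[] /eqP; [left | right].
Qed.

Lemma mpolyX_prime i f g : principal 'X_i (f * g) ->
  principal ('X_i : {mpoly F[n]}) f \/ principal ('X_i : {mpoly F[n]}) g.
Proof.
rewrite -linear_form_delta; apply: linear_form_prime.
by apply/rV0Pn; exists i; rewrite mxE !eqxx oner_neq0.
Qed.

Lemma mpolyX_neq0 i : ('X_i : {mpoly F[n]}) != 0.
Proof.
rewrite -linear_form_delta linear_form_eq0.
by apply/rV0Pn; exists i; rewrite mxE !eqxx oner_neq0.
Qed.

Lemma mpolyX_coprime i j m a : i != j ->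
  principal 'X_i ('X_j ^+ m * a) -> principal ('X_i : {mpoly F[n]}) a.
Proof.
move=> ij; elim: m => [|m IH]; first by rewrite mul1r.
rewrite exprS -mulrA => /mpolyX_prime[/principalP[g e]|/IH //].
have := congr1 (meval (fun t => (t == j)%:R : F)) e.
rewrite mevalM !mevalXU eqxx (negPf ij) mulr0 => /eqP.
by rewrite oner_eq0.
Qed.

Lemma mpolyX_exp_coprime i j m m' (a b : {mpoly F[n]}) : i != j ->
  'X_j ^+ m' * a = 'X_i ^+ m * b -> exists c, a = 'X_i ^+ m * c.
Proof.
move=> ij; elim: m a b => [|m IH] a b e; first by exists a; rewrite mul1r.
have : principal 'X_i ('X_j ^+ m' * a).
  by apply/principalP; exists ('X_i ^+ m * b); rewrite e exprS; ring.
move=> /(mpolyX_coprime ij)/principalP[a' ea].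
have [|c ec] := IH a' b.
  apply: (mulfI (mpolyX_neq0 i)).
  by rewrite [RHS]mulrA -exprS -e ea; ring.
by exists c; rewrite ea ec exprS; ring.
Qed.

(** Two distinct variables give X_i^m f = a q and X_j^m' f = b q. For nonzero q this yields X_j^m' a
    = X_i^m b, so X_i^m divides a and can be cancelled from the first equation. *)
Lemma principal_saturated q f : (1 < n)%N ->
  saturation (principal q) f -> principal q f.
Proof.
move=> n1 sat; pose i := Ordinal (ltnW n1); pose j := Ordinal n1.
have [m /principalP[a ea]] := sat i; have [m' /principalP[b eb]] := sat j.
have Xi m0 (k : 'I_n) : ('X_k ^+ m0 : {mpoly F[n]}) != 0.
  by rewrite expf_neq0 // mpolyX_neq0.
have [q0|q0] := eqVneq q 0.
  move: ea => /eqP; rewrite q0 mulr0 mulf_eq0 (negPf (Xi _ _)) /= => /eqP ->.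
  exact: ideal_gen0.
have ij : i != j by [].
have [|c ec] := @mpolyX_exp_coprime i j m m' a b ij.
  apply: (mulIf q0).
  by rewrite -!mulrA -ea -eb; ring.
apply/principalP; exists c; apply: (mulfI (Xi m i)).
by rewrite ea ec; ring.
Qed.

Lemma saturation_id I f : (forall g h, I h -> I (g * h)) -> I f -> saturation I f.
Proof. by move=> hI If i; exists 0%N; apply: hI. Qed.

Lemma same_scheme_mem I J f : (forall g h, I h -> I (g * h)) ->
  same_scheme I J -> I f -> saturation J f.
Proof. by move=> hI IJ If; apply/IJ; apply: saturation_id. Qed.

Lemma principal_ideal q g h : principal q h -> principal q (g * h).
Proof. exact: ideal_gen_mull. Qed.

Lemma same_scheme_principal_sub q q' : (1 < n)%N ->
  same_scheme (principal q) (principal q') -> principal q' q.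
Proof.
move=> n1 h; apply: principal_saturated => //.
by apply: (same_scheme_mem _ h); [exact: principal_ideal | exact: principal_id].
Qed.

(** By saturation each generator divides the other, and the units of a polynomial ring over a field
    are the nonzero constants. *)
Lemma same_scheme_principal q q' : (1 < n)%N ->
  same_scheme (principal q) (principal q') -> exists2 k, k != 0 & q = k *: q'.
Proof.
move=> n1 h; have /principalP[a ea] := same_scheme_principal_sub n1 h.
have /principalP[b eb] := same_scheme_principal_sub n1 (same_scheme_sym h).
have [q0|q0] := eqVneq q 0.
  by exists 1; rewrite ?oner_neq0 // scale1r eb q0 mulr0.
have ab : a * b = 1.
  by apply: (mulIf q0); rewrite mul1r [RHS]ea eb; ring.
have /andP[/eqP ea' _] := mpoly_intro_unit (etrans (mulrC b a) ab).
exists a@_0; last by rewrite -mul_mpolyC -ea'.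
apply: contraNneq (oner_neq0 {mpoly F[n]}) => a0.
by rewrite -ab ea' a0 mpolyC0 mul0r.
Qed.

Lemma principal_scale k q f : k != 0 -> principal (k *: q) f <-> principal q f.
Proof.
move=> k0; split=> /principalP[g ->]; apply/principalP.
  by exists (k *: g); rewrite -scalerAr -scalerAl.
by exists (k^-1 *: g); rewrite -scalerAr -scalerAl scalerA mulfV // scale1r.
Qed.

(** The substitution attached to c sends the form d to d minus a multiple of c, which vanishes only
    if d is proportional to c. *)
Lemma linear_form_in_principal (c d : 'rV[F]_n) :
  principal (linear_form c) (linear_form d) -> (d <= c)%MS.
Proof.
have [c0|/rV_neq0[j cj]] := eqVneq c 0.
  rewrite c0 linear_form0 => /principalP[g /eqP].
  by rewrite mulr0 linear_form_eq0 => /eqP ->; rewrite sub0mx.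
rewrite (principal_linear_form _ cj) /linear_form raddf_sum /=.
under eq_bigr => i _ do
  rewrite comp_mpolyZ comp_mpolyXU -tnth_nth tnth_mktuple scalerBr scalerA.
rewrite big_split /= -[X in X + _]/(linear_form d) sumrN -scaler_suml.
rewrite -linear_formZ => /eqP; rewrite subr_eq0 (inj_eq linear_form_inj).
by move=> /eqP ->; apply: scalemx_sub.
Qed.

Lemma same_scheme_linear_form (c d : 'rV[F]_n) : d != 0 -> (d <= c)%MS ->
  same_scheme (principal (linear_form c)) (principal (linear_form d)).
Proof.
move=> d0 /sub_rVP[k e]; apply: eq_same_scheme => f.
rewrite e linear_formZ principal_scale //.
by apply: contraNneq d0 => k0; rewrite e k0 scale0r.
Qed.

(** If the prime c divides g d and does not divide d, it divides g; so the union of the two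
    hyperplanes is cut out by the product of their equations. *)
Lemma idealI_linear_forms (c d : 'rV[F]_n) f : c != 0 -> ~~ (d <= c)%MS ->
  idealI (principal (linear_form c)) (principal (linear_form d)) f <->
  principal (linear_form c * linear_form d) f.
Proof.
move=> c0 nd; split=> [[hc /principalP[g e]]|/principalP[g ->]]; last first.
  by split; apply/principalP; [exists (g * linear_form d)|exists (g * linear_form c)];
    ring.
move: hc; rewrite e => /(linear_form_prime c0)[/principalP[a ->]|].
  by apply/principalP; exists a; rewrite mulrA.
by move/linear_form_in_principal; rewrite (negPf nd).
Qed.

End Ideals.

(** * Quadratic forms: smoothness, cones and rank *)

Section QuadraticForms.
Variable F : numClosedFieldType.

(** [S] need not be symmetric, so that determinants can be written down directly. The matrix that
    matters is [S + S^T], the Hessian of the form in the variables. *)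
Definition qform n m (S : 'M[F]_m) (l : 'I_m -> {mpoly F[n]}) : {mpoly F[n]} :=
  \sum_i \sum_j S i j *: (l i * l j).

Definition rowform m n (P : 'M[F]_(m, n)) (i : 'I_m) : {mpoly F[n]} :=
  linear_form (row i P).

Lemma qform_congr n m p (S : 'M[F]_m) (P : 'M[F]_(m, p)) (Q : 'M[F]_(p, n)) :
  qform S (rowform (P *m Q)) = qform (P^T *m S *m P) (rowform Q).
Proof.
have e i : rowform (P *m Q) i = \sum_k P i k *: rowform Q k.
  rewrite /rowform row_mul mulmx_sum_row linear_form_sum.
  by apply: eq_bigr => k _; rewrite linear_formZ mxE.
transitivity (\sum_i \sum_j \sum_k \sum_k'
    (P i k * S i j * P j k') *: (rowform Q k * rowform Q k')).
  apply: eq_bigr => i _; apply: eq_bigr => j _.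
  rewrite !e mulr_suml scaler_sumr; apply: eq_bigr => k _.
  rewrite mulr_sumr scaler_sumr; apply: eq_bigr => k' _.
  by rewrite -scalerAl -scalerAr !scalerA; congr (_ *: _); ring.
transitivity (\sum_i \sum_k \sum_j \sum_k'
    (P i k * S i j * P j k') *: (rowform Q k * rowform Q k')).
  by apply: eq_bigr => i _; exact: exchange_big.
rewrite exchange_big /=; apply: eq_bigr => k _.
transitivity (\sum_i \sum_k' \sum_j
    (P i k * S i j * P j k') *: (rowform Q k * rowform Q k')).
  by apply: eq_bigr => i _; exact: exchange_big.
rewrite exchange_big /=; apply: eq_bigr => k' _.
rewrite mxE scaler_suml exchange_big; apply: eq_bigr => j _ /=.
by rewrite mxE mulr_suml scaler_suml; apply: eq_bigr => i _; rewrite mxE.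
Qed.

Lemma rowform1 n i : rowform (1%:M : 'M[F]_n) i = 'X_i.
Proof. by rewrite /rowform row1 linear_form_delta. Qed.

Lemma eq_qform n m (S : 'M[F]_m) (l l' : 'I_m -> {mpoly F[n]}) :
  l =1 l' -> qform S l = qform S l'.
Proof.
by move=> e; apply: eq_bigr => i _; apply: eq_bigr => j _; rewrite !e.
Qed.

Lemma qform_rowform n m (S : 'M[F]_m) (P : 'M[F]_(m, n)) :
  qform S (rowform P) = qform (P^T *m S *m P) (fun i => 'X_i).
Proof. by rewrite -{1}[P]mulmx1 qform_congr; apply/eq_qform/rowform1. Qed.

Lemma qformZ n m k (S : 'M[F]_m) (l : 'I_m -> {mpoly F[n]}) :
  qform (k *: S) l = k *: qform S l.
Proof.
rewrite /qform scaler_sumr; apply: eq_bigr => i _.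
by rewrite scaler_sumr; apply: eq_bigr => j _; rewrite mxE scalerA.
Qed.

Lemma qformD n m (S T : 'M[F]_m) (l : 'I_m -> {mpoly F[n]}) :
  qform (S + T) l = qform S l + qform T l.
Proof.
rewrite /qform -big_split; apply: eq_bigr => i _.
by rewrite -big_split; apply: eq_bigr => j _; rewrite mxE scalerDl.
Qed.

Lemma qform0 n m (l : 'I_m -> {mpoly F[n]}) : qform 0 l = 0.
Proof. by rewrite -[0 in LHS](scale0r 0) qformZ scale0r. Qed.

Lemma qform_delta n m i j (l : 'I_m -> {mpoly F[n]}) :
  qform (delta_mx i j) l = l i * l j.
Proof.
rewrite /qform (bigD1 i) //= [X in _ + X]big1 ?addr0 => [|i' /negPf ne].
  rewrite (bigD1 j) //= big1 ?addr0 => [|j' /negPf ne].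
    by rewrite mxE !eqxx scale1r.
  by rewrite mxE ne andbF scale0r.
by rewrite big1 // => j' _; rewrite mxE ne scale0r.
Qed.

Lemma qform_comp n m (S : 'M[F]_m) (l : 'I_m -> {mpoly F[n]}) :
  qform S (fun i => 'X_i) \mPo [tuple l i | i < m] = qform S l.
Proof.
rewrite /qform raddf_sum; apply: eq_bigr => i _.
rewrite raddf_sum; apply: eq_bigr => j _.
by rewrite /= comp_mpolyZ rmorphM /= !comp_mpolyXU -!tnth_nth !tnth_mktuple.
Qed.

Lemma mderiv_mpolyX n (i j : 'I_n) :
  ('X_i)^`M(j) = (i == j)%:R :> {mpoly F[n]}.
Proof.
rewrite mderivX mnm1E; case: eqP => [->|_]; last by rewrite scale0r.
rewrite (_ : U_(j) - U_(j) = 0)%MM ?mpolyX0 ?scale1r //.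
by apply/mnmP => k; rewrite mnmBE subnn mnm0E.
Qed.

Lemma mderiv_qform n (S : 'M[F]_n) k :
  (qform S (fun i => 'X_i))^`M(k) = rowform (S + S^T) k.
Proof.
rewrite /qform raddf_sum /=.
under eq_bigr => i _.
  rewrite raddf_sum /=.
  under eq_bigr => j _ do rewrite mderivZ mderivM !mderiv_mpolyX scalerDr.
  rewrite big_split /=; over.
rewrite big_split /= (bigD1 k) //= [X in _ + X + _]big1 ?addr0; last first.
  move=> i /negPf ne; rewrite big1 // => j _.
  by rewrite ne mul0r scaler0.
rewrite [X in _ + X]exchange_big /= [X in _ + X](bigD1 k) //=.
rewrite [X in _ + (_ + X)]big1 ?addr0; last first.
  move=> i /negPf ne; rewrite big1 // => j _.
  by rewrite ne mulr0 scaler0.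
rewrite /rowform /linear_form -big_split; apply: eq_bigr => i _.
by rewrite !mxE eqxx mul1r mulr1 scalerDl.
Qed.

(** The partial derivatives of the form are the rows of [S + S^T]. *)
Lemma qform_inj n (S T : 'M[F]_n) :
  qform S (fun i => 'X_i) = qform T (fun i => 'X_i) -> S + S^T = T + T^T.
Proof.
move=> e; apply/row_matrixP => i; apply: linear_form_inj.
by rewrite -!/(rowform _ _) -!mderiv_qform e.
Qed.

Lemma homog2_qform n (q : {mpoly F[n]}) : q \is 2.-homog ->
  exists S, q = qform S (fun i => 'X_i).
Proof.
move=> /dhomogP h; rewrite [q]mpolyE big_seq.
elim/big_ind: _ => [|x y [S ->] [T ->]|m /h /= dm].
- by exists 0; rewrite qform0.
- by exists (S + T); rewrite qformD.
(* A monomial of degree 2 is divisible by some X_i, and the quotient, of degree 1, is some X_j. *)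
have [i mi] : exists i, m i != 0%N.
  apply/existsP; apply: contra_eqT dm => /existsPn m0.
  by rewrite mdegE big1 // => i _; apply/eqP; move: (m0 i); rewrite negbK.
have le : (U_(i) <= m)%MM.
  by apply/mnm_lepP => j; rewrite mnm1E; case: eqP => // <-; rewrite lt0n.
have := mdegD (m - U_(i)) U_(i); rewrite submK // dm mdeg1 addn1 => -[/esym/eqP].
move=> /mdeg1P[j /eqP ej].
exists (q@_m *: delta_mx j i); rewrite qformZ qform_delta -ej.
by rewrite -mpolyXD submK.
Qed.

Lemma homog_qform n (S : 'M[F]_n) : qform S (fun i => 'X_i) \is 2.-homog.
Proof.
apply: rpred_sum => i _; apply: rpred_sum => j _; apply: rpredZ.
by rewrite -mpolyXD dhomogX /= mdegD !mdeg1.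
Qed.

(** The factor 2 is that of Euler's identity. It shows that a kernel vector of [S + S^T] lies on the
    quadric, as 2 is invertible. *)
Lemma meval_qform n (S : 'M[F]_n) (p : 'rV_n) :
  2%:R * (qform S (fun i => 'X_i)).@[p 0] = (p *m (S + S^T) *m p^T) 0 0.
Proof.
have -> : (qform S (fun i => 'X_i)).@[p 0] = (p *m S *m p^T) 0 0.
  transitivity (\sum_j \sum_i p 0 i * S i j * p 0 j); last first.
    by rewrite mxE; apply: eq_bigr => j _; rewrite !mxE mulr_suml.
  rewrite exchange_big /qform raddf_sum; apply: eq_bigr => i _.
  rewrite raddf_sum; apply: eq_bigr => j _.
  by rewrite /= mevalZ mevalM !mevalXU; ring.
have e : p *m S^T *m p^T = (p *m S *m p^T)^T by rewrite !trmx_mul trmxK mulmxA.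
by rewrite mulmxDr mulmxDl e [RHS]mxE [X in _ + X]mxE mulr2n mulrDl mul1r.
Qed.

Lemma meval_rowform m n (P : 'M[F]_(m, n)) i (p : 'rV_n) :
  (rowform P i).@[p 0] = (p *m P^T) 0 i.
Proof.
rewrite meval_linear_form mxE; apply: eq_bigr => j _.
by rewrite !mxE mulrC.
Qed.

(** The gradient at p is p times the symmetric matrix [S + S^T], so the singular points are exactly
    the kernel vectors of that matrix. *)
Lemma smooth_qform n (S : 'M[F]_n) :
  smooth_quadratic_form (qform S (fun i => 'X_i)) <-> S + S^T \in unitmx.
Proof.
have sym : (S + S^T)^T = S + S^T by rewrite linearD /= trmxK addrC.
split=> [[_ sm]|uS].
  rewrite -row_free_unit -kermx_eq0; apply: contraT => /rowV0Pn[p /sub_kermxP e p0].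
  have [|i] := sm p p0.
    apply: (mulfI (_ : 2%:R != 0)); first by rewrite pnatr_eq0.
    by rewrite meval_qform e mul0mx mxE mulr0.
  by rewrite mderiv_qform meval_rowform sym e mxE eqxx.
split=> [|p p0 _]; first exact: homog_qform.
have : p *m (S + S^T) != 0.
  by apply: contraNneq p0 => e; rewrite -[p](mulmxK uS) e mul0mx.
by move/rV0Pn => [i ?]; exists i; rewrite mderiv_qform meval_rowform sym.
Qed.

(** A nondegenerate form in m independent linear forms. Smooth quadrics, cones, pairs of
    hyperplanes, double hyperplanes and zero all have equations of this shape, which makes their
    ranks comparable. *)
Definition has_qrank n (q : {mpoly F[n]}) m : Prop :=
  exists (S : 'M[F]_m) (P : 'M[F]_(m, n)),
    [/\ row_free P, S + S^T \in unitmx & q = qform S (rowform P)].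

Lemma has_qrankZ n (q : {mpoly F[n]}) m k :
  k != 0 -> has_qrank q m -> has_qrank (k *: q) m.
Proof.
move=> k0 [S [P [fP uS ->]]]; exists (k *: S), P; split; rewrite ?qformZ //.
by rewrite linearZ -scalerDr unitmxZ ?unitfE.
Qed.

(** The number m is the rank of the Hessian in the original variables, since row-free [P] does not
    change the rank of [S + S^T]. *)
Lemma has_qrank_unique n (q : {mpoly F[n]}) m m' :
  has_qrank q m -> has_qrank q m' -> m = m'.
Proof.
have rk m0 (H : 'M[F]_m0) (P : 'M_(m0, n)) : row_free P -> H \in unitmx ->
    \rank (P^T *m H *m P) = m0.
  move=> fP uH; rewrite mxrankMfree // mxrankMfree ?row_free_unit //.
  by rewrite mxrank_tr; apply/eqP.
have sym m0 (S : 'M[F]_m0) (P : 'M_(m0, n)) :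
    P^T *m S *m P + (P^T *m S *m P)^T = P^T *m (S + S^T) *m P.
  by rewrite !trmx_mul trmxK mulmxDr mulmxDl mulmxA.
move=> [S [P [fP uS ->]]] [S' [P' [fP' uS']]].
rewrite !qform_rowform => /qform_inj; rewrite !sym => /(congr1 mxrank).
by rewrite !rk.
Qed.

Lemma smooth_has_qrank n (q : {mpoly F[n]}) :
  smooth_quadratic_form q <-> has_qrank q n.
Proof.
split=> [sq|[S [P [fP uS ->]]]].
  have [S eq] := homog2_qform sq.1; exists S, 1%:M.
  split; first by rewrite row_free_unit unitmx1.
    by rewrite -smooth_qform -eq.
  by rewrite eq; apply: eq_qform => i; rewrite rowform1.
rewrite qform_rowform; apply/smooth_qform.
rewrite !trmx_mul trmxK mulmxA -mulmxDl -mulmxDr !unitmx_mul unitmx_tr uS.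
by rewrite -row_free_unit fP.
Qed.

Lemma row_free_rowsub m n (s : 'I_m -> 'I_n) (T : 'M[F]_n) :
  injective s -> T \in unitmx -> row_free (rowsub s T).
Proof.
move=> inj_s uT; apply/row_freeP; exists (invmx T *m (rowsub s 1%:M)^T).
rewrite rowsubE mulmxA mulmxK //; apply/matrixP => i j; rewrite !mxE.
rewrite (bigD1 (s i)) //= big1 ?addr0 => [|k /negPf ne]; last first.
  by rewrite !mxE eq_sym ne mul0r.
by rewrite !mxE eqxx mul1r (inj_eq inj_s) eq_sym.
Qed.

(** This is the rank normal form: as [P] has full row rank, its middle factor selects the first m
    rows of the invertible [T]. Up to [C], independent linear forms are part of a coordinate
    system. *)
Lemma row_free_extend m n (P : 'M[F]_(m, n)) : row_free P ->
  exists (C : 'M_m) (T : 'M_n) (s : 'I_m -> 'I_n),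
    [/\ C \in unitmx, T \in unitmx, injective s & P = C *m rowsub s T].
Proof.
move=> fP; have le : (m <= n)%N by rewrite -(eqP fP) rank_leq_col.
exists (col_ebase P), (row_ebase P), (widen_ord le).
split; rewrite ?col_ebase_unit ?row_ebase_unit //.
  by move=> i j /(congr1 val) /= ?; apply: val_inj.
rewrite -{1}(mulmx_ebase P) -mulmxA; congr (_ *m _).
rewrite rowsubE; congr (_ *m _); apply/matrixP => i j; rewrite !mxE.
by rewrite (eqP fP) ltn_ord andbT -(inj_eq val_inj).
Qed.

(** Selected coordinates are independent linear forms; conversely independent forms extend to
    coordinates up to an invertible [C], which is absorbed into the quadratic form. *)
Lemma cone_has_qrank m n (I : {mpoly F[n]} -> Prop) :
  is_cone_over_smooth_quadric m I <->
  exists2 q, has_qrank q m & same_scheme I (principal q).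
Proof.
split=> [[T [s [q [uT inj_s /smooth_has_qrank[S [P [fP uS eq]]] sI]]]]|].
  eexists; last exact: sI.
  exists S, (P *m rowsub s T); split=> //.
    have /row_freeP[P' eP] := fP.
    have /row_freeP[T' eT] := row_free_rowsub inj_s uT.
    apply/row_freeP; exists (T' *m P').
    by rewrite mulmxA -(mulmxA P) eT mulmx1.
  rewrite eq qform_rowform qform_congr -[RHS]qform_comp; congr (_ \mPo _).
  by apply: eq_mktuple => i; rewrite /rowform row_rowsub.
move=> [q [S [P [fP uS ->]]] sI].
have [C [T [s [uC uT inj_s eP]]]] := row_free_extend fP.
exists T, s, (qform (C^T *m S *m C) (fun i => 'X_i)); split=> //.
  apply/smooth_qform; rewrite !trmx_mul trmxK mulmxA -mulmxDl -mulmxDr.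
  by rewrite !unitmx_mul unitmx_tr uC uS.
rewrite (_ : [tuple _ | i < m] = [tuple rowform (rowsub s T) i | i < m]).
  by rewrite qform_comp -qform_congr -eP.
by apply: eq_mktuple => i; rewrite /rowform row_rowsub.
Qed.

Lemma has_qrank_smooth_quadric n (I : {mpoly F[n]} -> Prop) :
  is_smooth_quadric I <-> exists2 q, has_qrank q n & same_scheme I (principal q).
Proof. by split=> -[q /smooth_has_qrank sq sI]; exists q. Qed.

Lemma has_qrank_prod n (c d : 'rV[F]_n) : c != 0 -> ~~ (d <= c)%MS ->
  has_qrank (linear_form c * linear_form d) 2.
Proof.
move=> c0 nd; exists (mx2 0 1 0 0), (rows 2 [:: c; d]); split.
- exact: rows2_free.
- rewrite (_ : _ + _ = mx2 0 1 1 0).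
    by apply: mx2_unit; rewrite mul0r sub0r mul1r oppr_eq0 oner_neq0.
  apply/matrixP => -[[|[|//]] ?] -[[|[|//]] ?]; rewrite !mxE /=;
    by rewrite ?addr0 ?add0r.
rewrite /qform !big_ord2 !mxE /= !scale0r scale1r add0r !addr0.
by rewrite /rowform !rowK.
Qed.

Lemma has_qrank_sqr n (c : 'rV[F]_n) : c != 0 -> has_qrank (linear_form c ^+ 2) 1.
Proof.
move=> c0; exists 1%:M, (rows 1 [:: c]); split; first exact: rows1_free.
  by rewrite trmx1 unitmxE det_mx11 !mxE unitfE -natrD pnatr_eq0.
by rewrite /qform !big_ord1 mxE scale1r /rowform rowK.
Qed.

Lemma has_qrank0 n : has_qrank (0 : {mpoly F[n]}) 0.
Proof.
exists 0, 0; split; first by rewrite /row_free mxrank0.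
  by rewrite unitmxE det_mx00 unitr1.
by rewrite qform0.
Qed.

End QuadraticForms.

(** * The schemes N and L under a change of coordinates *)

Section SchemesOfAction.
Variable F : numClosedFieldType.

Lemma increasing_ord2 (f : 'I_2 -> 'I_2) :
  (f ord0 < f ord_max)%N -> f ord0 = ord0 /\ f ord_max = ord_max.
Proof.
by case: (f ord0) (f ord_max) => [[|[|//]] h0] [[|[|//]] h1] // _;
  split; apply: val_inj.
Qed.

Lemma minors2_mx22 (R : comNzRingType) (M : 'M[R]_2) d :
  minors2 M d <-> d = \det M.
Proof.
split=> [[f [g [ltf ltg ->]]]|->].
  have [f0 f1] := increasing_ord2 ltf; have [g0 g1] := increasing_ord2 ltg.
  by rewrite !det_mx22 !mxE f0 f1 g0 g1.
by exists id, id; split=> //; congr (\det _); apply/matrixP => i j; rewrite mxE.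
Qed.

Lemma schemeN_principal r (A : hypermatrix F 2 2 r) f :
  schemeN A f <-> principal (\det (matN A)) f.
Proof.
by split; apply: ideal_gen_sub => h e; rewrite -[h]mul1r; apply: ideal_genM;
  apply/minors2_mx22.
Qed.

(** The matrix N of the pullback is U^T N' V, where N' is the matrix of [B] in the new linear
    forms. *)
Lemma det_matN_act r s (B : hypermatrix F 2 2 s) (U V : 'M_2) (W : 'M_(s, r)) :
  \det (matN (act B U V W)) = (\det U * \det V) *:
  \det (\matrix_(a, b) \sum_c B (a, b, c) *: rowform W c).
Proof.
set N := \matrix_(a, b) _.
have -> : matN (act B U V W) =
    map_mx (@mpolyC r F) U^T *m N *m map_mx (@mpolyC r F) V.
  apply/matrixP => i j; rewrite !mxE.
  transitivity (\sum_k \sum_b \sum_a \sum_c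
      (B (a, b, c) * U a i * V b j * W c k) *: 'X_k).
    apply: eq_bigr => k _; rewrite ffunE scaler_suml /=.
    under eq_bigr do rewrite scaler_suml.
    rewrite exchange_big; apply: eq_bigr => b _ /=.
    by apply: eq_bigr => a _; rewrite scaler_suml.
  rewrite exchange_big; apply: eq_bigr => b _ /=; rewrite mxE mulr_suml.
  rewrite exchange_big; apply: eq_bigr => a _ /=; rewrite !mxE.
  rewrite mulr_sumr mulr_suml exchange_big; apply: eq_bigr => c _ /=.
  rewrite /rowform /linear_form scaler_sumr mulr_sumr mulr_suml.
  apply: eq_bigr => k _; rewrite !mxE mul_mpolyC [RHS]mulrC mul_mpolyC !scalerA.
  by congr (_ *: _); ring.
by rewrite !det_mulmx !det_map_mx det_tr mul_mpolyC [LHS]mulrC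
  mul_mpolyC scalerA mulrC.
Qed.

(** The matrix L with arbitrary polynomials in place of the variables x, so that a change [U] is
    expressed by taking [rowform U] for x. *)
Definition Lform n s (B : hypermatrix F 2 2 s) (x : 'I_2 -> {mpoly F[n]}) :
    'M_(2, s) := \matrix_(j, k) \sum_i B (i, j, k) *: x i.

Definition col_minor n s (M : 'M[{mpoly F[n]}]_(2, s)) k k' :=
  M ord0 k * M ord_max k' - M ord0 k' * M ord_max k.

(** All ordered pairs of columns are used, not only increasing ones: the ideal is the same, and
    stability under column operations needs no sorting of indices. *)
Definition Lideal n s (B : hypermatrix F 2 2 s) (x : 'I_2 -> {mpoly F[n]}) :=
  ideal_gen (fun h => exists k k', h = col_minor (Lform B x) k k').

Lemma det_mxsub_col_minor n s (M : 'M[{mpoly F[n]}]_(2, s)) (f : 'I_2 -> 'I_2) g :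
  (f ord0 < f ord_max)%N ->
  \det (mxsub f g M) = col_minor M (g ord0) (g ord_max).
Proof.
move=> lt; rewrite det_mx22 !mxE.
by have [-> ->] := increasing_ord2 lt.
Qed.

Lemma schemeL_Lideal s (A : hypermatrix F 2 2 s) f :
  schemeL A f <-> Lideal A (fun i => 'X_i) f.
Proof.
split; apply: ideal_gen_sub => h.
  move=> [f' [g [ltf ltg ->]]]; rewrite -[\det _]mul1r; apply: ideal_genM.
  by exists (g ord0), (g ord_max); rewrite det_mxsub_col_minor.
move=> [k [k' ->]].
have lt_minor (i j : 'I_s) : (i < j)%N ->
    schemeL A (col_minor (Lform A (fun i => 'X_i)) i j).
  move=> ij; rewrite -[col_minor _ _ _]mul1r; apply: ideal_genM.
  exists id, (fun t => if t == ord0 then i else j); split=> //.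
  by rewrite det_mxsub_col_minor.
case: (ltngtP k k') => [/lt_minor // | /lt_minor gt | /val_inj ->].
  rewrite (_ : col_minor _ _ _ = -1 * col_minor (Lform A (fun i => 'X_i)) k' k).
    exact: ideal_gen_mull.
  by rewrite /col_minor; ring.
by rewrite /col_minor subrr; exact: ideal_gen0.
Qed.

Lemma Lform_act n r s (B : hypermatrix F 2 2 s) (V : 'M_2) (W : 'M_(s, r))
    (x : 'I_2 -> {mpoly F[n]}) j k :
  Lform (act B 1%:M V W) x j k =
  \sum_c W c k *: (V ord0 j *: Lform B x ord0 c + V ord_max j *: Lform B x ord_max c).
Proof.
rewrite mxE.
transitivity (\sum_i \sum_b \sum_c (B (i, b, c) * V b j * W c k) *: x i).
  apply: eq_bigr => i _; rewrite ffunE scaler_suml (bigD1 i) //= [X in _ + X]big1.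
    rewrite addr0 scaler_suml; apply: eq_bigr => b _; rewrite scaler_suml.
    by apply: eq_bigr => c _; rewrite mxE eqxx mulr1.
  move=> a /negPf ne; rewrite big1 ?scale0r // => b _; rewrite big1 // => c _.
  by rewrite mxE ne mulr0 !mul0r.
rewrite exchange_big big_ord2 /= [X in X + _]exchange_big [X in _ + X]exchange_big.
rewrite -big_split; apply: eq_bigr => c _ /=; rewrite !mxE scalerDr !scaler_sumr.
by congr (_ + _); apply: eq_bigr => i _; rewrite !scalerA; congr (_ *: _); ring.
Qed.

(** Cauchy-Binet for V^T L W. Summing over ordered pairs of columns replaces the minors of [W] by
    products of two entries. *)
Lemma col_minor_act n r s (B : hypermatrix F 2 2 s) (V : 'M_2) (W : 'M_(s, r))
    (x : 'I_2 -> {mpoly F[n]}) k k' :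
  col_minor (Lform (act B 1%:M V W) x) k k' =
  \sum_c \sum_c' (W c k * W c' k' * \det V) *: col_minor (Lform B x) c c'.
Proof.
rewrite /col_minor !Lform_act [X in _ - X]mulrC !mulr_suml -sumrB.
apply: eq_bigr => c _; rewrite !mulr_sumr -sumrB; apply: eq_bigr => c' _.
rewrite det_mx22; move: (Lform B x) => M.
by rewrite -!mul_mpolyC !mpolyCM !mpolyCB !mpolyCM; ring.
Qed.

Lemma Lideal_act_sub n r s (B : hypermatrix F 2 2 s) (V : 'M_2) (W : 'M_(s, r))
    (x : 'I_2 -> {mpoly F[n]}) f :
  Lideal (act B 1%:M V W) x f -> Lideal B x f.
Proof.
apply: ideal_gen_sub => _ [k [k' ->]]; rewrite col_minor_act.
apply: ideal_gen_bigD => c; apply: ideal_gen_bigD => c'.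
by rewrite -mul_mpolyC; apply: ideal_genM; exists c, c'.
Qed.

(** The new minors are combinations of the old ones. Since [V] is invertible and [W] has a right
    inverse, the tensor can be recovered and the inclusion reversed; [U] only substitutes linear
    forms. *)
Lemma schemeL_act r s (B : hypermatrix F 2 2 s) (U V : 'M_2) (W : 'M_(s, r)) f :
  V \in unitmx -> row_free W ->
  schemeL (act B U V W) f <-> Lideal B (rowform U) f.
Proof.
move=> uV /row_freeP[W' eW]; rewrite schemeL_Lideal.
have e : Lform (act B U V W) (fun i => 'X_i) = Lform (act B 1%:M V W) (rowform U).
  have -> : act B U V W = act (act B 1%:M V W) U 1%:M 1%:M.
    by rewrite act_act mul1mx !mulmx1.
  apply/matrixP => j k; rewrite !mxE.
  transitivity (\sum_i \sum_a (act B 1%:M V W (a, j, k) * U a i) *: 'X_i).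
    apply: eq_bigr => i _; rewrite ffunE scaler_suml; apply: eq_bigr => a _.
    congr (_ *: _); rewrite (bigD1 j) //= [X in _ + X]big1 ?addr0 => [|b /negPf ne].
      rewrite (bigD1 k) //= big1 ?addr0 => [|c /negPf ne].
        by rewrite !mxE !eqxx !mulr1.
      by rewrite !mxE ne mulr0.
    by rewrite big1 // => c _; rewrite !mxE ne mulr0 mul0r.
  rewrite exchange_big; apply: eq_bigr => a _ /=.
  rewrite /rowform /linear_form scaler_sumr; apply: eq_bigr => i _.
  by rewrite mxE scalerA.
rewrite (_ : Lideal _ _ = Lideal (act B 1%:M V W) (rowform U)); last first.
  by rewrite /Lideal e.
split; first exact: Lideal_act_sub.
have eB : B = act (act B 1%:M V W) 1%:M (invmx V) W'.
  by rewrite act_act mulmx1 mulmxV // eW act1.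
rewrite {1}eB; exact: Lideal_act_sub.
Qed.

Lemma row_free_row_neq0 m n (W : 'M[F]_(m, n)) i : row_free W -> row i W != 0.
Proof.
move=> /row_freeP[W' eW]; apply/eqP => e.
have := congr1 (mulmx^~ W') e; rewrite rowE -mulmxA eW mulmx1 mul0mx.
by move/rowP/(_ i)/eqP; rewrite !mxE !eqxx oner_eq0.
Qed.

Lemma row_free_row_sub m n (W : 'M[F]_(m, n)) i j : row_free W -> i != j ->
  ~~ (row j W <= row i W)%MS.
Proof.
rewrite eq_sym => /row_freeP[W' eW] ij; apply/negP => /sub_rVP[k e].
have := congr1 (mulmx^~ W') e; rewrite !rowE -scalemxAl -!mulmxA eW !mulmx1.
by move/rowP/(_ j)/eqP; rewrite !mxE !eqxx (negPf ij) mulr0 oner_eq0.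
Qed.

Lemma mpolyX_rowform n (U : 'M[F]_n) i : U \in unitmx ->
  'X_i = \sum_a invmx U i a *: rowform U a.
Proof.
move=> uU; rewrite -rowform1 -(mulVmx uU) /rowform row_mul mulmx_sum_row.
by rewrite linear_form_sum; apply: eq_bigr => a _; rewrite linear_formZ mxE.
Qed.

End SchemesOfAction.

(** * Essential format, tensor rank and degeneracy from the normal forms *)

Section CoreTensors.
Variable F : numClosedFieldType.

(* A decidable criterion for [slices_free]: each slice has a nonzero entry at a
   position where all other slices of the same direction vanish. *)
Definition separated_slices (p q s : nat) (e : seq (nat * nat * nat)) : bool :=
  [&& all (fun i => has (fun j => has (fun k =>
        all (fun i' => ((i', j, k) \in e) == (i' == i)) (iota 0 p))
        (iota 0 s)) (iota 0 q)) (iota 0 p),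
      all (fun j => has (fun i => has (fun k =>
        all (fun j' => ((i, j', k) \in e) == (j' == j)) (iota 0 q))
        (iota 0 s)) (iota 0 p)) (iota 0 q)
    & all (fun k => has (fun i => has (fun j =>
        all (fun k' => ((i, j, k') \in e) == (k' == k)) (iota 0 s))
        (iota 0 q)) (iota 0 p)) (iota 0 s)].

Lemma slices_free_core p q s e :
  separated_slices p q s e -> slices_free (core (F := F) p q s e).
Proof.
have mem n (i : 'I_n) : (val i \in iota 0 n) by rewrite mem_iota /=.
have sum n (u : 'rV[F]_n) (f : 'I_n -> F) (i : 'I_n) :
    (forall i', f i' = (val i' == val i)%:R) -> \sum_i' u 0 i' * f i' = u 0 i.
  move=> h; rewrite (bigD1 i) //= h eqxx mulr1 big1 ?addr0 // => i' ne.
  by rewrite h (inj_eq val_inj) (negPf ne) mulr0.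
move=> /and3P[/allP hx /allP hy /allP hz].
split=> u u0; apply/rowP => i; rewrite mxE.
- have /hasP[j] := hx _ (mem _ i); rewrite mem_iota /= => ltj.
  move=> /hasP[k]; rewrite mem_iota /= => ltk /allP h.
  rewrite -[RHS](u0 (Ordinal ltj) (Ordinal ltk)); symmetry; apply: sum => i'.
  by rewrite ffunE /= (eqP (h _ (mem _ i'))).
- have /hasP[j] := hy _ (mem _ i); rewrite mem_iota /= => ltj.
  move=> /hasP[k]; rewrite mem_iota /= => ltk /allP h.
  rewrite -[RHS](u0 (Ordinal ltj) (Ordinal ltk)); symmetry; apply: sum => i'.
  by rewrite ffunE /= (eqP (h _ (mem _ i'))).
- have /hasP[j] := hz _ (mem _ i); rewrite mem_iota /= => ltj.
  move=> /hasP[k]; rewrite mem_iota /= => ltk /allP h.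
  rewrite -[RHS](u0 (Ordinal ltj) (Ordinal ltk)); symmetry; apply: sum => i'.
  by rewrite ffunE /= (eqP (h _ (mem _ i'))).
Qed.

Lemma sum_of_decomposables_core p q s e : uniq e ->
  sum_of_decomposables (core (F := F) p q s e) (size e).
Proof.
move=> ue; pose z := (0, 0, 0)%N.
exists (fun t => \row_i (val i == (nth z e t).1.1)%:R).
exists (fun t => \row_i (val i == (nth z e t).1.2)%:R).
exists (fun t => \row_i (val i == (nth z e t).2)%:R).
apply/ffunP => -[[i j] k]; rewrite sum_ffunE ffunE /=.
(* As [e] has no duplicates, the indicator of membership counts the occurrences, one per term of the
   decomposition. *)
transitivity (\sum_(x <- e) (((val i, val j, val k) == x)%:R : F)).
  elim: e ue => [|x e IH] /=; first by rewrite big_nil.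
  case/andP => xe /IH ue; rewrite big_cons -ue inE.
  by case: eqP => [->|_]; rewrite ?(negPf xe) ?addr0 ?add0r.
rewrite (big_nth z) big_mkord; apply: eq_bigr => t _.
rewrite !ffunE !mxE /=; case: (nth z e t) => [[a b] c] /=.
by rewrite !xpair_eqE -!natrM !mulnb.
Qed.

(** The decomposition is z_0 x_0 y_0 + z_1 (x_0 y_1 + x_1 y_0) + z_2 x_1 y_1 = (z_0 - z_1) x_0 y_0 +
    (z_2 - z_1) x_1 y_1 + z_1 (x_0 + x_1) (y_0 + y_1). *)
Lemma sum_of_decomposables_core2 :
  sum_of_decomposables (core2 : hypermatrix F 2 2 3) 3.
Proof.
pose u (l : seq (seq F)) n (t : 'I_3) : 'rV[F]_n := \row_i nth 0 (nth [::] l t) i.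
exists (u [:: [:: 1; 0]; [:: 0; 1]; [:: 1; 1]] 2%N).
exists (u [:: [:: 1; 0]; [:: 0; 1]; [:: 1; 1]] 2%N).
exists (u [:: [:: 1; -1; 0]; [:: 0; -1; 1]; [:: 0; 1; 0]] 3%N).
apply: hypermatrix22P => k; rewrite !sum_ffunE !big_ord_recl !big_ord0.
rewrite !ffunE !mxE /=.
by case: k => [[|[|[|//]]] h] /=; split; ring.
Qed.

Lemma trilinear_unit_vec3 p q r (A : hypermatrix F p q r) (x : 'I_p -> F^o) y k :
  trilinear A x y (unit_vec k) = \sum_i \sum_j A (i, j, k) * x i * y j.
Proof.
apply: eq_bigr => i _; apply: eq_bigr => j _; rewrite (bigD1 k) //= big1 ?addr0.
  by rewrite /unit_vec eqxx mulr1 /GRing.scale /= mulrA.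
by move=> k' /negPf ne; rewrite /unit_vec ne mulr0 scaler0.
Qed.

Lemma trilinear_unit_vec2 p q r (A : hypermatrix F p q r) (x : 'I_p -> F^o) z j :
  trilinear A x (unit_vec j) z = \sum_i \sum_k A (i, j, k) * x i * z k.
Proof.
apply: eq_bigr => i _; rewrite (bigD1 j) //= [X in _ + X]big1 ?addr0; last first.
  move=> j' /negPf ne; rewrite big1 // => k _.
  by rewrite /unit_vec ne mulr0 mul0r scaler0.
apply: eq_bigr => k _; rewrite /unit_vec eqxx mulr1.
by rewrite /GRing.scale /= mulrA.
Qed.

Lemma trilinear_unit_vec1 p q r (A : hypermatrix F p q r) (y : 'I_q -> F^o) z i :
  trilinear A (unit_vec i) y z = \sum_j \sum_k A (i, j, k) * y j * z k.
Proof.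
rewrite /trilinear (bigD1 i) //= [X in _ + X]big1 ?addr0; last first.
  move=> i' /negPf ne; rewrite big1 // => j _; rewrite big1 // => k _.
  by rewrite /unit_vec ne !mul0r scaler0.
apply: eq_bigr => j _; apply: eq_bigr => k _; rewrite /unit_vec eqxx mul1r.
by rewrite /GRing.scale /= mulrA.
Qed.

Lemma trilinear_z0 p q r (A : hypermatrix F p q r) (x : 'I_p -> F^o) y z :
  z =1 (fun=> 0) -> trilinear A x y z = 0.
Proof.
move=> z0; rewrite /trilinear; do 3! (rewrite big1 // => ? _).
by rewrite z0 mulr0 scaler0.
Qed.

(** Take x and y whose new coordinates are (1, 0): the equations without z then only see the
    vanishing first slice. As s < r, a nonzero z is killed by all the linear forms in [W], which
    settles the equations involving z. *)
Lemma degenerate_act r s (B : hypermatrix F 2 2 s) (U V : 'M_2) (W : 'M_(s, r)) :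
  U \in unitmx -> V \in unitmx -> (s < r)%N ->
  (forall c, B (ord0, ord0, c) = 0) -> degenerate (act B U V W).
Proof.
move=> uU uV lt_sr B0.
have corner (T : 'M[F]_2) : T \in unitmx ->
    exists2 x : 'rV_2, x != 0 & x *m T^T = delta_mx 0 ord0.
  move=> uT; exists (delta_mx 0 ord0 *m invmx T^T).
    apply/eqP => e; have := congr1 (mulmx^~ T^T) e.
    rewrite mulmxKV ?unitmx_tr // mul0mx => /rowP/(_ ord0)/eqP.
    by rewrite !mxE !eqxx oner_eq0.
  by rewrite mulmxKV // unitmx_tr.
have [x x0 ex] := corner U uU; have [y y0 ey] := corner V uV.
have [z z0 ez] := exists_left_kernel W^T lt_sr.
have sumT m n (T : 'M[F]_(m, n)) (v : 'rV_n) a :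
    \sum_i T a i *: (v 0 i : F^o) = (v *m T^T) 0 a.
  by rewrite mxE; apply: eq_bigr => i _; rewrite mxE mulrC.
exists x, y, z; split=> //; split=> [k|j|i].
- rewrite -(trilinear_unit_vec3 _ (x 0) (y 0)) trilinear_act /trilinear.
  rewrite big1 // => a _; rewrite big1 // => b _; rewrite big1 // => c _.
  rewrite !sumT ex ey !mxE /=.
  case: (eqVneq a ord0) => [->|]; last by rewrite !mul0r scaler0.
  case: (eqVneq b ord0) => [->|]; last by rewrite mulr0 mul0r scaler0.
  by rewrite B0 scale0r.
- rewrite -(trilinear_unit_vec2 _ (x 0) (z 0)) trilinear_act trilinear_z0 // => c.
  by rewrite sumT ez mxE.
- rewrite -(trilinear_unit_vec1 _ (y 0) (z 0)) trilinear_act trilinear_z0 // => c.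
  by rewrite sumT ez mxE.
Qed.

(** The equations without z already force x = 0 or y = 0: row-free [W] allows them to be read on
    [B], as the vanishing of a bilinear map to F^s. *)
Lemma nondegenerate_act r s (B : hypermatrix F 2 2 s) (U V : 'M_2)
    (W : 'M_(s, r)) :
  U \in unitmx -> V \in unitmx -> row_free W ->
  (forall x y : 'I_2 -> F,
    (forall c, \sum_a \sum_b B (a, b, c) * x a * y b = 0) ->
    (forall a, x a = 0) \/ (forall b, y b = 0)) ->
  ~ degenerate (act B U V W).
Proof.
move=> uU uV fW hB [x [y [z [[x0 y0 _] [hk _ _]]]]].
have sumT m n (T : 'M[F]_(m, n)) (v : 'rV_n) a :
    \sum_i T a i *: (v 0 i : F^o) = (v *m T^T) 0 a.
  by rewrite mxE; apply: eq_bigr => i _; rewrite mxE mulrC.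
pose x' := x *m U^T; pose y' := y *m V^T.
pose w := \row_c \sum_a \sum_b B (a, b, c) * x' 0 a * y' 0 b.
have w0 : w *m W = 0.
  apply/rowP => k; rewrite [RHS]mxE -[RHS](hk k).
  rewrite -(trilinear_unit_vec3 _ (x 0) (y 0)) trilinear_act /trilinear mxE.
  under eq_bigr do rewrite mxE mulr_suml.
  rewrite exchange_big; apply: eq_bigr => a _ /=.
  under eq_bigr do rewrite mulr_suml.
  rewrite exchange_big; apply: eq_bigr => b _ /=.
  apply: eq_bigr => c _; rewrite !sumT -/x' -/y' (sum_unit_vec k (W c)).
  by rewrite /GRing.scale /= !mulrA.
have nz (T : 'M[F]_2) (v : 'rV_2) :
    T \in unitmx -> v != 0 -> ~ forall a, (v *m T^T) 0 a = 0.
  rewrite -unitmx_tr => uT /eqP v0 h; apply: v0; rewrite -[v](mulmxK uT).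
  have -> : v *m T^T = 0 by apply/rowP => a; rewrite h mxE.
  exact: mul0mx.
case: (hB (x' 0) (y' 0)) => [c|/(nz _ _ uU x0)|/(nz _ _ uV y0)] //.
have /row_freeP[W' eW] := fW.
have : w = 0 by rewrite -[w]mulmx1 -eW mulmxA w0 mul0mx.
by move/rowP/(_ c); rewrite !mxE.
Qed.

(* The slice matrix sum_t w_t(k) u_t^T v_t has determinant D w_0(k) w_1(k), and its
   polarization in k gives the third equation. *)
Lemma core4a_not_sum2 : ~ sum_of_decomposables (core4a : hypermatrix F 2 2 2) 2.
Proof.
move=> [u [v [w e]]].
have h i j k : core4a (i, j, k) = u ord0 0 i * v ord0 0 j * w ord0 0 k +
    u ord_max 0 i * v ord_max 0 j * w ord_max 0 k :> F.
  by rewrite e sum_ffunE big_ord2 !ffunE.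
pose D := (u ord0 0 ord0 * u ord_max 0 ord_max - u ord0 0 ord_max * u ord_max 0 ord0)
  * (v ord0 0 ord0 * v ord_max 0 ord_max - v ord0 0 ord_max * v ord_max 0 ord0).
have d0 : w ord0 0 ord0 * w ord_max 0 ord0 * D =
    core4a (ord0, ord0, ord0) * core4a (ord_max, ord_max, ord0) -
    core4a (ord0, ord_max, ord0) * core4a (ord_max, ord0, ord0).
  by rewrite !h /D; ring.
have d1 : w ord0 0 ord_max * w ord_max 0 ord_max * D =
    core4a (ord0, ord0, ord_max) * core4a (ord_max, ord_max, ord_max) -
    core4a (ord0, ord_max, ord_max) * core4a (ord_max, ord0, ord_max).
  by rewrite !h /D; ring.
have d01 : (w ord0 0 ord0 * w ord_max 0 ord_max +
      w ord0 0 ord_max * w ord_max 0 ord0) * D =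
    core4a (ord0, ord0, ord0) * core4a (ord_max, ord_max, ord_max) +
    core4a (ord0, ord0, ord_max) * core4a (ord_max, ord_max, ord0) -
    core4a (ord0, ord_max, ord0) * core4a (ord_max, ord0, ord_max) -
    core4a (ord0, ord_max, ord_max) * core4a (ord_max, ord0, ord0).
  by rewrite !h /D; ring.
have c1 := h ord_max ord_max ord_max.
clearbody D; move: d0 d1 d01 c1; rewrite !ffunE /=.
move: (w ord0 0 ord0) (w ord0 0 ord_max) (w ord_max 0 ord0) (w ord_max 0 ord_max).
move=> a0 a1 b0 b1; rewrite !(mul0r, mulr0, mul1r, mulr1, subr0, addr0, sub0r, oppr0).
move=> d0 /eqP d1 /eqP d01 c1.
(* The slice matrices of [core4a] have determinant -1 for the first k and 0 for the second, and the
   polarization is 0. So D, a0 and b0 are nonzero, one of a1, b1 vanishes, then so does the other,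
   against the entry 1 in the second slice. *)
have : a0 * b0 * D != 0 by rewrite d0 oppr_eq0 oner_neq0.
rewrite !mulf_eq0 !negb_or => /andP[/andP[a00 b00] D0].
move: d1 d01; rewrite !mulf_eq0 (negPf D0) !orbF => /orP[] /eqP z; rewrite z.
  rewrite mul0r addr0 mulf_eq0 (negPf a00) => /eqP z'.
  by move: c1 => /eqP; rewrite z z' !mulr0 addr0 oner_eq0.
rewrite mulr0 add0r mulf_eq0 (negPf b00) orbF => /eqP z'.
by move: c1 => /eqP; rewrite z z' !mulr0 addr0 oner_eq0.
Qed.

End CoreTensors.

(** * Equations of N and L for the normal forms *)

Section Cases.
Variable F : numClosedFieldType.

(** Missing rows and entries are 0, so trailing zero rows are left out below. *)
Definition mx_of_seq n (l : seq (seq F)) : 'M_n :=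
  \matrix_(i, j) nth 0 (nth [::] l i) j.

Definition Nform r s (B : hypermatrix F 2 2 s) (W : 'M_(s, r)) : 'M_2 :=
  \matrix_(a, b) \sum_c B (a, b, c) *: rowform W c.

Lemma schemeN_act r s (B : hypermatrix F 2 2 s) (U V : 'M_2) (W : 'M_(s, r)) :
  U \in unitmx -> V \in unitmx ->
  same_scheme (schemeN (act B U V W)) (principal (\det (Nform B W))).
Proof.
rewrite !unitmxE !unitfE => uU uV; apply: eq_same_scheme => f.
by rewrite schemeN_principal det_matN_act principal_scale // mulf_neq0.
Qed.

Ltac expand_Nform :=
  rewrite det_mx22 !mxE ?big_ord_recl ?big_ord0 !ffunE /= !(scale0r, scale1r).

Lemma det_Nform_core1 r (W : 'M_(4, r)) : row_free W ->
  has_qrank (\det (Nform core1 W)) 4.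
Proof.
move=> fW; exists (mx_of_seq 4 [:: [:: 0; 0; 0; 1]; [:: 0; 0; -1; 0]]), W.
split=> //; last first.
  rewrite /qform !big_ord_recl !big_ord0 !mxE /= !(scale0r, scale1r, scaleN1r).
  by expand_Nform; ring.
(* [T] is [S + S^T] itself, which is an involution. *)
pose T := mx_of_seq 4 [:: [:: 0; 0; 0; 1]; [:: 0; 0; -1; 0]; [:: 0; -1; 0; 0];
  [:: 1; 0; 0; 0]].
apply: (proj1 (@mulmx1_unit _ _ _ T _)).
apply/matrixP => -[[|[|[|[|i]]]] hi] // -[[|[|[|[|j]]]] hj] //;
  rewrite !mxE !big_ord_recl big_ord0 !mxE /=; ring.
Qed.

Lemma det_Nform_core2 r (W : 'M_(3, r)) : row_free W ->
  has_qrank (\det (Nform core2 W)) 3.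
Proof.
move=> fW; exists (mx_of_seq 3 [:: [:: 0; 0; 1]; [:: 0; -1; 0]]), W.
split=> //; last first.
  rewrite /qform !big_ord_recl !big_ord0 !mxE /= !(scale0r, scale1r, scaleN1r).
  by expand_Nform; ring.
(* The inverse of [S + S^T], whose middle entry is -2 because the diagonal of [S] is doubled. *)
pose T := mx_of_seq 3 [:: [:: 0; 0; 1]; [:: 0; - 2%:R^-1; 0]; [:: 1; 0; 0]].
apply: (proj1 (@mulmx1_unit _ _ _ T _)).
apply/matrixP => -[[|[|[|i]]] hi] // -[[|[|[|j]]] hj] //;
  rewrite !mxE !big_ord_recl big_ord0 !mxE /=; by field.
Qed.

Lemma schemeN_two_hyperplanes r s (B : hypermatrix F 2 2 s) (U V : 'M_2)
    (W : 'M_(s, r)) i j :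
  U \in unitmx -> V \in unitmx -> row_free W -> i != j -> (1 < r)%N ->
  \det (Nform B W) = - (rowform W i * rowform W j) ->
  is_two_hyperplanes (schemeN (act B U V W)).
Proof.
move=> uU uV fW ij r1 e; exists (row i W), (row j W).
have nd := row_free_row_sub fW ij.
have [i0 j0] := (row_free_row_neq0 i fW, row_free_row_neq0 j fW).
split=> //.
  move=> /same_scheme_sym/(same_scheme_principal_sub r1)/linear_form_in_principal.
  by rewrite (negPf nd).
apply: same_scheme_trans (schemeN_act B W uU uV) _; apply: eq_same_scheme => f.
rewrite idealI_linear_forms // e -scaleN1r principal_scale //.
by rewrite oppr_eq0 oner_neq0.
Qed.

Lemma schemeN_double_hyperplane r s (B : hypermatrix F 2 2 s) (U V : 'M_2)
    (W : 'M_(s, r)) i :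
  U \in unitmx -> V \in unitmx -> row_free W ->
  \det (Nform B W) = - (rowform W i ^+ 2) ->
  is_double_hyperplane (schemeN (act B U V W)).
Proof.
move=> uU uV fW e; exists (row i W); first exact: row_free_row_neq0.
apply: same_scheme_trans (schemeN_act B W uU uV) _; apply: eq_same_scheme => f.
by rewrite e -scaleN1r principal_scale // oppr_eq0 oner_neq0.
Qed.

Ltac expand_minor k k' :=
  case: k => [[|[|[|k]]] ?] //; case: k' => [[|[|[|k']]] ?] //;
  rewrite /col_minor !mxE !big_ord2 !ffunE /= !(scale0r, scale1r).

(** Up to sign the nonzero minors are x_0 x_1 and x_1^2, generating x_1 times the irrelevant ideal:
    the ideals differ and only their saturations agree. One extra factor X_i, a combination of x_0
    and x_1, makes up for the difference. *)
Lemma Lideal_core3a (U : 'M[F]_2) : U \in unitmx ->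
  same_scheme (Lideal core3a (rowform U)) (principal (rowform U ord_max)).
Proof.
move=> uU f; set x := rowform U; split=> sat i; have [m h] := sat i.
  exists m; apply: ideal_gen_sub h => _ [k [k' ->]].
  expand_minor k k'; apply/principalP;
    first [exists 0; ring | exists (x ord0); ring | exists (- x ord0); ring
          | exists (x ord_max); ring | exists (- x ord_max); ring].
exists m.+1; have [g eg] := (principalP _ _).1 h.
rewrite exprS -mulrA eg {1}(mpolyX_rowform i uU) big_ord2 -/x.
have x01 : Lideal core3a x (x ord_max * x ord0).
  rewrite -[_ * _]mul1r; apply: ideal_genM; exists (inord 1), ord0.
  by rewrite /col_minor !mxE !big_ord2 !ffunE /= inordK //= !(scale0r, scale1r); ring.
have x11 : Lideal core3a x (x ord_max * x ord_max).
  rewrite -[_ * _]mul1r; apply: ideal_genM; exists (inord 1), ord_max.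
  by rewrite /col_minor !mxE !big_ord2 !ffunE /= inordK //= !(scale0r, scale1r); ring.
rewrite -!mul_mpolyC.
rewrite (_ : (_ + _) * _ = (invmx U i ord0)%:MP * g * (x ord_max * x ord0) +
  (invmx U i ord_max)%:MP * g * (x ord_max * x ord_max)); last by ring.
by apply: ideal_genD; apply: ideal_gen_mull.
Qed.

Lemma Lideal_core3b n (x : 'I_2 -> {mpoly F[n]}) f :
  Lideal core3b x f <-> principal (x ord0 * x ord_max) f.
Proof.
split; apply: ideal_gen_sub => h.
  move=> [k [k' ->]]; expand_minor k k'; apply/principalP;
    first [exists 0; ring | exists 1; ring | exists (-1); ring].
move->; rewrite -[_ * _]mul1r; apply: ideal_genM; exists ord_max, ord0.
by rewrite /col_minor !mxE !big_ord2 !ffunE /= !(scale0r, scale1r); ring.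
Qed.

Lemma Lideal_core4a n (x : 'I_2 -> {mpoly F[n]}) f :
  Lideal core4a x f <-> principal (x ord_max ^+ 2) f.
Proof.
split; apply: ideal_gen_sub => h.
  move=> [k [k' ->]]; expand_minor k k'; apply/principalP;
    first [exists 0; ring | exists 1; ring | exists (-1); ring].
move->; rewrite -[_ ^+ _]mul1r; apply: ideal_genM; exists ord0, ord_max.
by rewrite /col_minor !mxE !big_ord2 !ffunE /= !(scale0r, scale1r); ring.
Qed.

Lemma Lideal_core5a n (x : 'I_2 -> {mpoly F[n]}) f :
  Lideal core5a x f <-> principal (x ord_max ^+ 2) f.
Proof.
split; apply: ideal_gen_sub => h.
  move=> [k [k' ->]]; expand_minor k k'; apply/principalP;
    first [exists 0; ring | exists 1; ring | exists (-1); ring].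
move->; rewrite -[_ ^+ _]mul1r; apply: ideal_genM; exists ord0, ord_max.
by rewrite /col_minor !mxE !big_ord2 !ffunE /= !(scale0r, scale1r); ring.
Qed.

Lemma Lideal_zero n s (B : hypermatrix F 2 2 s) (x : 'I_2 -> {mpoly F[n]}) f :
  (forall k k', col_minor (Lform B x) k k' = 0) -> Lideal B x f <-> principal 0 f.
Proof.
move=> z; split; apply: ideal_gen_sub => h; last by move=> ->; exact: ideal_gen0.
by move=> [k [k' ->]]; rewrite z; exact: ideal_gen0.
Qed.

Lemma col_minor_core4b n (x : 'I_2 -> {mpoly F[n]}) k k' :
  col_minor (Lform core4b x) k k' = 0.
Proof. by rewrite !ord1 /col_minor subrr. Qed.

Lemma col_minor_core5a' n (x : 'I_2 -> {mpoly F[n]}) k k' :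
  col_minor (Lform core5a' x) k k' = 0.
Proof. by expand_minor k k'; ring. Qed.

Lemma col_minor_core5b n (x : 'I_2 -> {mpoly F[n]}) k k' :
  col_minor (Lform core5b x) k k' = 0.
Proof. by rewrite !ord1 /col_minor subrr. Qed.

(** Exchanging x and y turns M into L, so that no separate study of M is needed; it also
    interchanges [core5a] and [core5a']. *)
Definition swap p q r (A : hypermatrix F p q r) : hypermatrix F q p r :=
  [ffun t => A (t.1.2, t.1.1, t.2)].

Lemma schemeM_swap r (A : hypermatrix F 2 2 r) : schemeM A = schemeL (swap A).
Proof.
rewrite /schemeM /schemeL (_ : matM A = matL (swap A)) //.
by apply/matrixP => i k; rewrite !mxE; apply: eq_bigr => j _; rewrite ffunE.
Qed.

Lemma swap_act p q r p' q' r' (B : hypermatrix F p' q' r')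
    (U : 'M_(p', p)) (V : 'M_(q', q)) (W : 'M_(r', r)) :
  swap (act B U V W) = act (swap B) V U W.
Proof.
apply/ffunP => -[[j i] k]; rewrite !ffunE /= exchange_big /=.
apply: eq_bigr => b _; apply: eq_bigr => a _; apply: eq_bigr => c _.
by rewrite ffunE /=; ring.
Qed.

Lemma swap_core p q s e :
  swap (core p q s e) =
  core q p s [seq ((x.1.2, x.1.1), x.2) | x <- e] :> hypermatrix F _ _ _.
Proof.
apply/ffunP => -[[j i] k]; rewrite !ffunE /=; congr (_%:R).
have inj : injective (fun x : nat * nat * nat => ((x.1.2, x.1.1), x.2)).
  by move=> [[a b] c] [[a' b'] c'] [-> -> ->].
by rewrite -(mem_map inj e (val i, val j, val k)).
Qed.

Lemma essential_format_unitmx r s (B : hypermatrix F 2 2 s) (U V : 'M_2)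
    (W : 'M_(s, r)) :
  U \in unitmx -> V \in unitmx -> row_free W -> slices_free B ->
  has_essential_format (act B U V W) 2 2 s.
Proof.
by move=> uU uV fW; apply: essential_format_act; rewrite ?row_free_unit.
Qed.

End Cases.

(** * Each normal form realizes one of the cases *)

Section Realization.
Variables (F : numClosedFieldType) (r : nat).
Hypothesis hr : (4 <= r)%N.

Definition realizes (A : hypermatrix F 2 2 r) (c : case_label) : Prop :=
  case_occurs A c /\ case_conclusion A c.

Lemma r_gt1 : (1 < r)%N. Proof. exact: leq_trans hr. Qed.

Lemma eq0_ord2 (x : 'I_2 -> F) :
  x ord0 = 0 -> x ord_max = 0 -> forall a, x a = 0.
Proof.
move=> x0 x1 [[|[|//]] h]; [rewrite -x0 | rewrite -x1]; congr x; exact: val_inj.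
Qed.

Lemma essential_format_core s e (U V : 'M[F]_2) (W : 'M_(s, r)) :
  U \in unitmx -> V \in unitmx -> row_free W -> separated_slices 2 2 s e ->
  has_essential_format (act (core 2 2 s e) U V W) 2 2 s.
Proof.
by move=> uU uV fW se; apply: essential_format_unitmx => //; apply: slices_free_core.
Qed.

Lemma tensor_rank_core p q s p' q' r' e (U : 'M[F]_(p, p')) (V : 'M[F]_(q, q'))
    (W : 'M_(s, r')) p1 q1 r1 :
  has_essential_format (act (core p q s e) U V W) p1 q1 r1 ->
  uniq e -> (size e <= maxn p1 (maxn q1 r1))%N ->
  has_tensor_rank (act (core p q s e) U V W) (size e).
Proof.
move=> ess ue le; apply: has_tensor_rank_max ess _ le.
exact/sum_of_decomposables_act/sum_of_decomposables_core.
Qed.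

Lemma realizes_core1 A : has_form A (core1 (F := F)) ->
  realizes A (if r == 4%N then Case1a else Case1b).
Proof.
move=> [U [V [W [uU uV fW ->]]]].
have ess : has_essential_format (act core1 U V W) 2 2 4.
  exact: essential_format_core.
have rk : has_tensor_rank (act core1 U V W) 4 by apply: tensor_rank_core ess _ _.
have sN := schemeN_act core1 W uU uV.
have qN := det_Nform_core1 fW.
have nd : ~ degenerate (act core1 U V W).
  apply: nondegenerate_act => // x y xy.
  move: (xy ord0) (xy (inord 1)) (xy (inord 2)) (xy ord_max).
  rewrite !big_ord2 !ffunE /= !inordK //= !(mul1r, mul0r, add0r, addr0).
  have [x0 _ _|x0] := eqVneq (x ord0) 0.
    have [x1 _ _|x1] := eqVneq (x ord_max) 0; first by left; apply: eq0_ord2.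
    move=> /eqP; rewrite mulf_eq0 (negPf x1) => /eqP y0.
    move=> /eqP; rewrite mulf_eq0 (negPf x1) => /eqP y1.
    by right; apply: eq0_ord2.
  move=> /eqP; rewrite mulf_eq0 (negPf x0) => /eqP y0.
  move=> /eqP; rewrite mulf_eq0 (negPf x0) => /eqP y1.
  by right; apply: eq0_ord2.
case: eqP => r4.
  split; split=> //.
    apply/has_qrank_smooth_quadric; exists (\det (Nform core1 W)) => //.
    by rewrite [X in has_qrank _ X]r4.
  by rewrite /concise [X in has_essential_format _ _ _ X]r4.
have r5 : (5 <= r)%N by rewrite ltn_neqAle hr andbT eq_sym; apply/eqP.
split; first by split=> //; apply/cone_has_qrank; exists (\det (Nform core1 W)).
split=> // -[_ /(_ _ _ _ ess.1)[_ _]].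
by rewrite leqNgt r5.
Qed.

Lemma realizes_core2 A : has_form A (core2 (F := F)) -> realizes A Case2.
Proof.
move=> [U [V [W [uU uV fW ->]]]].
have ess : has_essential_format (act core2 U V W) 2 2 3.
  exact: essential_format_core.
split.
  apply/cone_has_qrank; exists (\det (Nform core2 W)); last exact: schemeN_act.
  exact: det_Nform_core2.
split=> //; last first.
- apply: has_tensor_rank_max ess _ _ => //.
  exact/sum_of_decomposables_act/sum_of_decomposables_core2.
- move=> [_ /(_ _ _ _ ess.1)[_ _]].
  by rewrite leqNgt hr.
(* The three components are the coefficients of the product of the polynomials x_0 + x_1 t and y_0 +
   y_1 t, which vanishes only if a factor does. *)
apply: nondegenerate_act => // x y xy.
move: (xy ord0) (xy (inord 1)) (xy ord_max).
rewrite !big_ord2 !ffunE /= !inordK //= !(mul1r, mul0r, add0r, addr0).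
have [x0 _|x0] := eqVneq (x ord0) 0.
  have [x1 _|x1] := eqVneq (x ord_max) 0; first by left; apply: eq0_ord2.
  move=> /eqP; rewrite x0 mul0r add0r mulf_eq0 (negPf x1) => /eqP y0.
  move=> /eqP; rewrite mulf_eq0 (negPf x1) => /eqP y1.
  by right; apply: eq0_ord2.
move=> /eqP; rewrite mulf_eq0 (negPf x0) => /eqP y0.
move=> /eqP; rewrite y0 mulr0 addr0 mulf_eq0 (negPf x0) => /eqP y1 _.
by right; apply: eq0_ord2.
Qed.

Lemma realizes_core3a A : has_form A (core3a (F := F)) -> realizes A Case3a.
Proof.
move=> [U [V [W [uU uV fW ->]]]].
have ess : has_essential_format (act core3a U V W) 2 2 3.
  exact: essential_format_core.
split; last first.
  split=> //; last exact: tensor_rank_core ess _ _.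
  by apply: degenerate_act => // c; rewrite ffunE.
split.
  apply: (@schemeN_two_hyperplanes _ _ _ _ _ _ _ ord0 (inord 1)) => //.
  - by rewrite -(inj_eq val_inj) /= inordK.
  - exact: r_gt1.
  rewrite det_mx22 !mxE !big_ord3 !ffunE /= inordK //= !(scale0r, scale1r).
  by ring.
exists (row ord_max U); first by apply: row_free_row_neq0; rewrite row_free_unit.
apply: same_scheme_trans (Lideal_core3a uU).
by apply: eq_same_scheme => f; apply: schemeL_act.
Qed.

Lemma realizes_core3b A : has_form A (core3b (F := F)) -> realizes A Case3b.
Proof.
move=> [U [V [W [uU uV fW ->]]]].
have ess : has_essential_format (act core3b U V W) 2 2 2.
  exact: essential_format_core.
split; last first.
  split=> //; last exact: tensor_rank_core ess _ _.
  by apply: degenerate_act => //; [exact: ltnW | move=> c; rewrite ffunE].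
split.
  apply: (@schemeN_two_hyperplanes _ _ _ _ _ _ _ ord0 ord_max) => //.
    exact: r_gt1.
  rewrite det_mx22 !mxE !big_ord2 !ffunE /= !(scale0r, scale1r).
  by ring.
have fU : row_free U by rewrite row_free_unit.
have nd : ~~ (row ord_max U <= row ord0 U)%MS by exact: row_free_row_sub.
exists (row ord0 U), (row ord_max U); split; rewrite ?row_free_row_neq0 //.
  move=> /same_scheme_sym/(same_scheme_principal_sub (isT : (1 < 2)%N))
    /linear_form_in_principal.
  by rewrite (negPf nd).
apply: eq_same_scheme => f; rewrite schemeL_act // Lideal_core3b.
by rewrite idealI_linear_forms // row_free_row_neq0.
Qed.

(** The essential format only gives the lower bound 2. A decomposition with two terms would pull
    back along the inverse change of coordinates to one of [core4a], which has none. *)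
Lemma tensor_rank_core4a (U V : 'M[F]_2) (W : 'M_(2, r)) :
  U \in unitmx -> V \in unitmx -> row_free W ->
  has_essential_format (act core4a U V W) 2 2 2 ->
  has_tensor_rank (act core4a U V W) 3.
Proof.
move=> uU uV fW ess; split.
  exact/sum_of_decomposables_act/sum_of_decomposables_core.
move=> m sm; have [m2 _ _] := ess.2 _ _ _ (sum_of_decomposables_reducible sm).
rewrite ltn_neqAle m2 andbT; apply/eqP => m_eq; move: sm; rewrite -m_eq => sm.
apply: (@core4a_not_sum2 F); rewrite -row_free_unit in uU.
rewrite -row_free_unit in uV.
have [U' [V' [W' ->]]] := act_inv core4a uU uV fW.
exact: sum_of_decomposables_act.
Qed.

Lemma realizes_core4a A : has_form A (core4a (F := F)) -> realizes A Case4a.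
Proof.
move=> [U [V [W [uU uV fW ->]]]].
have ess : has_essential_format (act core4a U V W) 2 2 2.
  exact: essential_format_core.
split; last first.
  split=> //; last exact: tensor_rank_core4a.
  by apply: degenerate_act => //; [exact: ltnW | move=> c; rewrite ffunE].
split.
  apply: (@schemeN_double_hyperplane _ _ _ _ _ _ _ ord0) => //.
  rewrite det_mx22 !mxE !big_ord2 !ffunE /= !(scale0r, scale1r).
  by ring.
exists (row ord_max U); first by apply: row_free_row_neq0; rewrite row_free_unit.
by apply: eq_same_scheme => f; rewrite schemeL_act // Lideal_core4a.
Qed.

Lemma realizes_core4b A : has_form A (core4b (F := F)) -> realizes A Case4b.
Proof.
move=> [U [V [W [uU uV fW ->]]]].
have ess : has_essential_format (act core4b U V W) 2 2 1.
  exact: essential_format_core.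
split; last first.
  split=> //; last exact: tensor_rank_core ess _ _.
  by apply: degenerate_act => //; [exact: r_gt1 | move=> c; rewrite ffunE].
split.
  apply: (@schemeN_double_hyperplane _ _ _ _ _ _ _ ord0) => //.
  rewrite det_mx22 !mxE !big_ord1 !ffunE /= !(scale0r, scale1r).
  by ring.
move=> d md; have : schemeL (act core4b U V W) d.
  by rewrite -[d]mul1r; apply: ideal_genM.
rewrite schemeL_act // Lideal_zero; last exact: col_minor_core4b.
by move/principalP => [g ->]; rewrite mulr0.
Qed.

Lemma row_free_delta_mul n (U : 'M[F]_n) i : U \in unitmx ->
  row_free (delta_mx 0 i *m U : 'rV_n).
Proof.
move=> uU; rewrite /row_free rank_rV -rowE.
by rewrite row_free_row_neq0 // row_free_unit.
Qed.

Lemma det_matN_eq0 s (B : hypermatrix F 2 2 s) (U V : 'M_2) (W : 'M_(s, r)) :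
  \det (Nform B W) = 0 -> \det (matN (act B U V W)) = 0.
Proof. by move=> e; rewrite det_matN_act -/(Nform B W) e scaler0. Qed.

Lemma is_whole_schemeL s (B : hypermatrix F 2 2 s) (U V : 'M_2) (W : 'M_(s, r)) :
  V \in unitmx -> row_free W ->
  (forall k k', col_minor (Lform B (rowform U)) k k' = 0) ->
  is_whole_space (schemeL (act B U V W)).
Proof.
move=> uV fW z; apply: eq_same_scheme => f.
by rewrite schemeL_act // Lideal_zero.
Qed.

Lemma is_double_schemeL_core5a (U V : 'M[F]_2) (W : 'M_(2, r)) :
  U \in unitmx -> V \in unitmx -> row_free W ->
  is_double_hyperplane (schemeL (act core5a U V W)).
Proof.
move=> uU uV fW; exists (row ord_max U).
  by apply: row_free_row_neq0; rewrite row_free_unit.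
by apply: eq_same_scheme => f; rewrite schemeL_act // Lideal_core5a.
Qed.

Lemma realizes_core5a A : has_form A (core5a (F := F)) -> realizes A Case5a.
Proof.
move=> [U [V [W [uU uV fW ->]]]].
have ess : has_essential_format (act core5a U V W) 1 2 2.
  (* [core5a] has slices dependent in the first direction, as only one x-variable occurs. It is
     pulled back from a tensor of format (1, 2, 2) whose slices are independent. *)
  have -> : core5a = act (core 1 2 2 [:: (0, 0, 0); (0, 1, 1)]%N)
      (delta_mx 0 ord_max) 1%:M 1%:M :> hypermatrix F 2 2 2.
    apply: hypermatrix22P => k; rewrite !ffunE !big_ord1 !big_ord2 !ffunE /= !mxE /=.
    by case: k => [[|[|//]] ?]; rewrite ?mxE /=; split; ring.
  rewrite act_act !mul1mx; apply: essential_format_act => //.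
  - exact: row_free_delta_mul.
  - by rewrite row_free_unit.
  - exact: slices_free_core.
split; last first.
  split; last exact: tensor_rank_core ess _ _.
    by apply: degenerate_act => //; [exact: ltnW | move=> c; rewrite ffunE].
  by left.
split.
  apply: det_matN_eq0.
  rewrite det_mx22 !mxE !big_ord2 !ffunE /= !(scale0r, scale1r).
  by ring.
left; split; first exact: is_double_schemeL_core5a.
rewrite schemeM_swap swap_act swap_core /=.
by apply: is_whole_schemeL => // k k'; exact: col_minor_core5a'.
Qed.

Lemma realizes_core5a' A : has_form A (core5a' (F := F)) -> realizes A Case5a.
Proof.
move=> [U [V [W [uU uV fW ->]]]].
have ess : has_essential_format (act core5a' U V W) 2 1 2.
  have -> : core5a' = act (core 2 1 2 [:: (0, 0, 0); (1, 0, 1)]%N)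
      1%:M (delta_mx 0 ord_max) 1%:M :> hypermatrix F 2 2 2.
    apply: hypermatrix22P => k; rewrite !ffunE !big_ord2 !big_ord1.
    rewrite !big_ord2 !ffunE /= !mxE /=.
    by case: k => [[|[|//]] ?]; rewrite ?mxE /=; split; ring.
  rewrite act_act !mul1mx; apply: essential_format_act => //.
  - by rewrite row_free_unit.
  - exact: row_free_delta_mul.
  - exact: slices_free_core.
split; last first.
  split; last exact: tensor_rank_core ess _ _.
    by apply: degenerate_act => //; [exact: ltnW | move=> c; rewrite ffunE].
  by right.
split.
  apply: det_matN_eq0.
  rewrite det_mx22 !mxE !big_ord2 !ffunE /= !(scale0r, scale1r).
  by ring.
right; split.
  rewrite schemeM_swap swap_act swap_core /=.
  exact: is_double_schemeL_core5a.
by apply: is_whole_schemeL => // k k'; exact: col_minor_core5a'.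
Qed.

Lemma realizes_core5b A : has_form A (core5b (F := F)) -> realizes A Case5b.
Proof.
move=> [U [V [W [uU uV fW ->]]]].
have ess : has_essential_format (act core5b U V W) 1 1 1.
  have -> : core5b = act (core 1 1 1 [:: (0, 0, 0)]%N)
      (delta_mx 0 ord_max) (delta_mx 0 ord_max) 1%:M :> hypermatrix F 2 2 1.
    apply: hypermatrix22P => k; rewrite !ffunE !big_ord1 !ffunE /= !mxE /=.
    by rewrite !ord1 /=; split; ring.
  rewrite act_act !mul1mx; apply: essential_format_act => //.
  - exact: row_free_delta_mul.
  - exact: row_free_delta_mul.
  - exact: slices_free_core.
split; last first.
  split=> //; last exact: tensor_rank_core ess _ _.
  by apply: degenerate_act => //; [exact: r_gt1 | move=> c; rewrite ffunE].
split.
- apply: det_matN_eq0.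
  rewrite det_mx22 !mxE !big_ord1 !ffunE /= !(scale0r, scale1r).
  by ring.
- by apply: is_whole_schemeL => // k k'; exact: col_minor_core5b.
rewrite schemeM_swap swap_act swap_core /=.
by apply: is_whole_schemeL => // k k'; exact: col_minor_core5b.
Qed.

Lemma exists_realized_case A : A <> 0 -> exists c, realizes A c.
Proof.
case/classification => [/realizes_core1|[/realizes_core2|[/realizes_core3a|
  [/realizes_core3b|[/realizes_core4a|[/realizes_core4b|[/realizes_core5a|
  [/realizes_core5a'|/realizes_core5b]]]]]]]] h; eexists; exact: h.
Qed.

(** * Mutual exclusion of the cases *)

Definition quadric_rank (c : case_label) : nat :=
  match c with
  | Case1a | Case1b => 4
  | Case2 => 3
  | Case3a | Case3b => 2
  | Case4a | Case4b => 1
  | Case5a | Case5b => 0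
  end.

Lemma same_schemeN_has_qrank (A : hypermatrix F 2 2 r) q m :
  same_scheme (schemeN A) (principal q) -> has_qrank q m ->
  has_qrank (\det (matN A)) m.
Proof.
move=> sq hq.
have : same_scheme (principal (\det (matN A))) (principal q).
  apply: same_scheme_trans sq; apply: eq_same_scheme => f.
  by rewrite schemeN_principal.
by move=> /(same_scheme_principal r_gt1)[k k0 ->]; apply: has_qrankZ.
Qed.

Lemma is_two_hyperplanesP n (I : {mpoly F[n]} -> Prop) : is_two_hyperplanes I ->
  exists c d : 'rV_n, [/\ c != 0, ~~ (d <= c)%MS &
    same_scheme I (principal (linear_form c * linear_form d))].
Proof.
move=> [c [d [c0 d0 ncd sI]]]; exists c, d.
have nd : ~~ (d <= c)%MS by apply: contra_notN ncd; exact: same_scheme_linear_form.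
split=> //; apply: same_scheme_trans sI _; apply: eq_same_scheme => f.
exact: idealI_linear_forms.
Qed.

Lemma case_occurs_has_qrank (A : hypermatrix F 2 2 r) c : case_occurs A c ->
  has_qrank (\det (matN A)) (quadric_rank c).
Proof.
have two : is_two_hyperplanes (schemeN A) -> has_qrank (\det (matN A)) 2.
  move=> /is_two_hyperplanesP[a [b [a0 nb /same_schemeN_has_qrank]]].
  by apply; exact: has_qrank_prod.
have double : is_double_hyperplane (schemeN A) -> has_qrank (\det (matN A)) 1.
  move=> [a a0 /same_schemeN_has_qrank]; apply; exact: has_qrank_sqr.
case: c => /=.
- move=> [r4 /has_qrank_smooth_quadric[q hq sq]]; rewrite -[X in has_qrank _ X]r4.
  exact: same_schemeN_has_qrank sq hq.
- move=> [_ /cone_has_qrank[q hq sq]]; exact: same_schemeN_has_qrank sq hq.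
- move=> /cone_has_qrank[q hq sq]; exact: same_schemeN_has_qrank sq hq.
- by case=> /two.
- by case=> /two.
- by case=> /double.
- by case=> /double.
- by case=> -> _; exact: has_qrank0.
- by case=> -> _ _; exact: has_qrank0.
Qed.

(** Both schemes are defined by principal ideals, whose generators would be proportional although
    their degrees are 1 and 2. *)
Lemma hyperplane_not_two_hyperplanes n (I : {mpoly F[n]} -> Prop) : (1 < n)%N ->
  is_hyperplane I -> is_two_hyperplanes I -> False.
Proof.
move=> n1 [l l0 sl] /is_two_hyperplanesP[c [d [c0 nd sI]]].
have := same_scheme_trans (same_scheme_sym sl) sI.
move=> /(same_scheme_principal n1)[k k0 e].
have homog1 (a : 'rV[F]_n) : linear_form a \is 1.-homog.
  by apply: rpred_sum => i _; rewrite rpredZ // dhomogX /= mdeg1.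
suff : 1%N = 2%N by [].
apply: (@dhomog_uniq _ _ _ (linear_form l) 1 2); rewrite ?linear_form_eq0 //.
by rewrite e; apply: rpredZ; rewrite -[2%N]/(1 + 1)%N dhomogM.
Qed.

Lemma double_hyperplane_not_whole n (I : {mpoly F[n]} -> Prop) : (1 < n)%N ->
  is_double_hyperplane I -> is_whole_space I -> False.
Proof.
move=> n1 [l l0 sl] sI.
have := same_scheme_trans (same_scheme_sym sl) sI.
move=> /(same_scheme_principal n1)[k k0 /eqP].
by rewrite scaler0 expf_eq0 linear_form_eq0 (negPf l0).
Qed.

Lemma case_occurs_inj (A : hypermatrix F 2 2 r) c c' :
  case_occurs A c -> case_occurs A c' -> c = c'.
Proof.
move=> oc oc'; have := has_qrank_unique (case_occurs_has_qrank oc)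
  (case_occurs_has_qrank oc').
have no3 := @hyperplane_not_two_hyperplanes 2 (schemeL A) isT.
have no4 : is_double_hyperplane (schemeL A) ->
    (forall d, minors2 (matL A) d -> d = 0) -> False.
  move=> dL z; apply: (@double_hyperplane_not_whole 2 _ isT dL).
  apply: eq_same_scheme => f; split; apply: ideal_gen_sub => h.
    by move=> /z ->; exact: ideal_gen0.
  by move=> ->; exact: ideal_gen0.
have noL := @double_hyperplane_not_whole 2 (schemeL A) isT.
have noM := @double_hyperplane_not_whole 2 (schemeM A) isT.
(* Equality of the quadric ranks discards cases from different groups. Eight ordered pairs remain:
   two for each of the groups (1), (3), (4) and (5). *)
case: c oc => oc; case: c' oc' => oc' e; try discriminate e; try reflexivity;
  exfalso; clear e; case: oc; case: oc'.
- by move=> r5 _ r4 _; move: r5; rewrite [X in (_ < X)%N]r4.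
- by move=> r4 _ r5 _; move: r5; rewrite [X in (_ < X)%N]r4.
- by move=> _ h' _ h; exact: no3.
- by move=> _ h' _ h; exact: no3.
- by move=> _ h' _ h; exact: no4.
- by move=> _ h' _ h; exact: no4.
- by move=> _ wL wM _ [[dL _]|[dM _]]; [exact: noL | exact: noM].
- by move=> _ [[dL _]|[dM _]] _ wL wM; [exact: noL | exact: noM].
Qed.

End Realization.

Theorem mainTheorem5 (R : realType) (r : nat) (hr : (4 <= r)%N)
    (A : hypermatrix (R[i]) 2 2 r) (hA : A <> 0) :
  (exists! c : case_label, case_occurs A c) /\
  (forall c : case_label, case_occurs A c -> case_conclusion A c).
Proof.
have [c [occ concl]] := exists_realized_case hr hA.
have uniq_c c' : case_occurs A c' -> c = c' by exact: (case_occurs_inj hr occ).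
split; first by exists c.
by move=> c' /uniq_c <-.
Qed.
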